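(* Let $\ell$ be an odd positive integer, let $\mathbb{Z}_\varepsilon:=\mathbb{Z}[q,q^{-1}]/(\phi_\ell(q))$ and $\varepsilon:=\bar q\in\mathbb{Z}_\varepsilon$, and let $G\in\{M_n,GL_n\}$. Fix any total order on $\{1,\dots,n\}^{\times 2}$. Then the set of ordered monomials $$\mathrm{B}^M_{GL}:=\Big\{\prod_{i,j=1}^n t_{i,j}^{N_{i,j}} : 0\le N_{i,j}\le \ell-1\ \forall i,j\Big\}$$ (product taken in increasing order of $(i,j)$ for the fixed total order), viewed as a subset of $\mathcal{O}_\varepsilon^{\mathbb{Z}_\varepsilon}(M_n)\subset\mathcal{O}_\varepsilon^{\mathbb{Z}_\varepsilon}(GL_n)$, is a basis of $\mathcal{O}_\varepsilon^{\mathbb{Z}_\varepsilon}(M_n)$ as a module over $\mathcal{O}^{\mathbb{Z}_\varepsilon}(M_n)$, and a basis of $\mathcal{O}_\varepsilon^{\mathbb{Z}_\varepsilon}(GL_n)$ as a module over $\mathcal{O}^{\mathbb{Z}_\varepsilon}(GL_n)$ (module structures via the quantum Frobenius morphism). In particular both modules are free of rank $\ell^{\dim G}$, i.e. of rank $\ell^{n^2}$.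
   Context: For a commutative unital ring $R$ and invertible $q\in R$, $\mathcal{O}_q^{R}(M_n)$ is the unital associative $R$-algebra with generators $t_{i,j}$ ($1\le i,j\le n$) and relations $t_{i,j}t_{i,k}=q\,t_{i,k}t_{i,j}$, $t_{i,k}t_{h,k}=q\,t_{h,k}t_{i,k}$ for $j<k$, $i<h$, and $t_{i,l}t_{j,k}=t_{j,k}t_{i,l}$, $t_{i,k}t_{j,l}-t_{j,l}t_{i,k}=(q-q^{-1})t_{i,l}t_{j,k}$ for $i<j$, $k<l$. The quantum determinant $D_q:=\sum_{\sigma\in S_n}(-q)^{\ell(\sigma)}t_{1,\sigma(1)}\cdots t_{n,\sigma(n)}$ ($\ell(\sigma)$ the length of $\sigma$) is central, and $\mathcal{O}_q^{R}(GL_n):=\mathcal{O}_q^{R}(M_n)[D_q^{-1}]$. Let $\mathbb{Z}_q:=\mathbb{Z}[q,q^{-1}]$ with $q$ an indeterminate, $\phi_\ell$ the $\ell$-th cyclotomic polynomial. Set $\mathcal{O}_\varepsilon^{\mathbb{Z}_\varepsilon}(G):=\mathcal{O}_q^{\mathbb{Z}_q}(G)/\phi_\ell(q)\mathcal{O}_q^{\mathbb{Z}_q}(G)$ for $G\in\{M_n,GL_n\}$; images of $t_{i,j}$, $D_q$ there are again denoted $t_{i,j}$, and $D_\varepsilon$. Let $\mathcal{O}^{\mathbb{Z}}(M_n)=\mathbb{Z}[\bar t_{i,j}]$ be the polynomial ring (coordinate ring of the $n\times n$ matrix scheme over $\mathbb{Z}$), $D$ the ordinary determinant, $\mathcal{O}^{\mathbb{Z}}(GL_n)=\mathcal{O}^{\mathbb{Z}}(M_n)[D^{-1}]$,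 and $\mathcal{O}^{\mathbb{Z}_\varepsilon}(G):=\mathbb{Z}_\varepsilon\otimes_{\mathbb{Z}}\mathcal{O}^{\mathbb{Z}}(G)$. The quantum Frobenius morphism is the (injective) algebra morphism $\mathcal{O}^{\mathbb{Z}_\varepsilon}(G)\to\mathcal{O}_\varepsilon^{\mathbb{Z}_\varepsilon}(G)$ given by $\bar t_{i,j}\mapsto t_{i,j}^{\ell}$ (and $D^{-1}\mapsto D_\varepsilon^{-\ell}$ for $GL_n$); its image is central, so $\mathcal{O}_\varepsilon^{\mathbb{Z}_\varepsilon}(G)$ is an $\mathcal{O}^{\mathbb{Z}_\varepsilon}(G)$-module through it. *)

(* Defs.v *)
From HB Require Import structures.
From mathcomp Require Import all_boot all_order all_algebra all_fingroup.
From mathcomp Require Import cyclotomic.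
From mathcomp Require Import mpoly.
Set Implicit Arguments. Unset Strict Implicit. Unset Printing Implicit Defensive.
Import GRing.Theory.
Local Open Scope ring_scope.

(* Z_eps = Z[q,q^-1]/(Phi_l(q)), eps = image of q: characterised as
   (R, eps) such that the ring map Z[q,q^-1] -> R, q |-> eps, is surjective
   with kernel Phi_l(q) Z[q,q^-1].  Laurent polynomials are written
   p(q) q^-k with p in Z[q]. *)
Definition zev (R : comUnitRingType) (eps : R) (p : {poly int}) : R :=
  (map_poly (fun z : int => z%:~R) p).[eps].

Definition is_Zeps (l : nat) (R : comUnitRingType) (eps : R) : Prop :=
  [/\ eps \is a GRing.unit,
      (forall x : R, exists (p : {poly int}) (k : nat), x = zev eps p * eps ^- k)
    & (forall (p : {poly int}) (k : nat),
         zev eps p * eps ^- k = 0 <->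
         exists (r : {poly int}) (k' : nat), p * 'X^k' = r * 'Phi_l * 'X^k)].

Definition qrel (R : comUnitRingType) (q : R) (n : nat) (A : algType R)
  (t : 'I_n -> 'I_n -> A) : Prop :=
  [/\ forall i j k : 'I_n, (j < k)%N -> t i j * t i k = q *: (t i k * t i j),
      forall i h k : 'I_n, (i < h)%N -> t i k * t h k = q *: (t h k * t i k),
      forall i j k l : 'I_n, (i < j)%N -> (k < l)%N -> t i l * t j k = t j k * t i l
    & forall i j k l : 'I_n, (i < j)%N -> (k < l)%N ->
        t i k * t j l - t j l * t i k = (q - q^-1) *: (t i l * t j k)].

Definition perm_length (n : nat) (s : 'S_n) : nat :=
  #|[set p : 'I_n * 'I_n | (p.1 < p.2)%N && (s p.2 < s p.1)%N]|.

(* quantum determinant; for q = 1 in a commutative algebra it is the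
   ordinary determinant since (-1)^(length s) is the sign of s *)
Definition qdet (R : comUnitRingType) (q : R) (n : nat) (A : algType R)
  (t : 'I_n -> 'I_n -> A) : A :=
  \sum_(s : 'S_n) (- q) ^+ perm_length s *: \prod_(i < n) t i (s i).

Definition invertible (A : nzRingType) (x : A) : Prop :=
  exists y : A, x * y = 1 /\ y * x = 1.

Definition is_Oq_Mn (R : comUnitRingType) (q : R) (n : nat) (A : algType R)
  (t : 'I_n -> 'I_n -> A) : Prop :=
  qrel q t /\
  forall (B : algType R) (u : 'I_n -> 'I_n -> B), qrel q u ->
    exists f : {lrmorphism A -> B},
      (forall i j, f (t i j) = u i j) /\
      (forall g : {lrmorphism A -> B}, (forall i j, g (t i j) = u i j) -> g =1 f).

(* (AL, iota) is the localization A[d^-1] (d central): universal property *)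
Definition is_localization (R : comUnitRingType) (A : algType R) (d : A)
  (AL : algType R) (iota : {lrmorphism A -> AL}) : Prop :=
  invertible (iota d) /\
  forall (B : algType R) (g : {lrmorphism A -> B}), invertible (g d) ->
    exists h : {lrmorphism AL -> B},
      (forall x, h (iota x) = g x) /\
      (forall h' : {lrmorphism AL -> B}, (forall x, h' (iota x) = g x) -> h' =1 h).

Notation Pol R n := {mpoly R[#|{: 'I_n * 'I_n}|]}.

Definition tbar (R : comUnitRingType) (n : nat) (i j : 'I_n) : Pol R n :=
  'X_(enum_rank (i, j)).

Definition Dbar (R : comUnitRingType) (n : nat) : Pol R n := qdet 1 (@tbar R n).

Definition qFrob (R : comUnitRingType) (n : nat) (A : algType R)
  (t : 'I_n -> 'I_n -> A) (l : nat) (p : Pol R n) : A :=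
  mmap (fun c : R => c%:A) (fun k => t (enum_val k).1 (enum_val k).2 ^+ l) p.

Definition omono (R : comUnitRingType) (n l : nat) (A : algType R)
  (t : 'I_n -> 'I_n -> A) (ord : rel ('I_n * 'I_n))
  (N : {ffun 'I_n * 'I_n -> 'I_l}) : A :=
  \prod_(p <- sort ord (enum {: 'I_n * 'I_n})) t p.1 p.2 ^+ N p.

(* Main.v *)
Require Import Defs.
From HB Require Import structures.
From mathcomp Require Import all_boot all_order all_algebra all_fingroup.
From mathcomp Require Import cyclotomic algC.
From mathcomp Require Import mpoly.
From mathcomp Require Import boolp functions.
From mathcomp Require Import zify ring.
Import GRing.Theory.
Local Open Scope ring_scope.
(* Idea: a diagonal quantum matrix of invertible commuting shifts, multiplied by
   elementary quantum matrices (diagonal entries k, k^-1 in two adjacent rows and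
   one adjacent off-diagonal entry x, with k x = q x k), is again a quantum matrix.
   Acting on power series in the entries x, a suitable sequence of such products
   fills all n^2 positions, and looking at the lowest-order term in the newest x
   shows that words in the t_ij with distinct contents stay linearly independent.
   As every word can be reordered modulo words of smaller weight, this makes the
   resulting representation of O_q(M_n) faithful.  Multiplying by an elementary
   matrix does not change the quantum determinant, and, at a primitive l-th root of
   unity, commutes with taking l-th powers of the entries, because
   (u + v)^l = u^l + v^l for suitably q-commuting u, v.  Hence in the representation,
   and so in O_q(M_n), the t_ij^l and D are central and det(t_ij^l) = D^l.  Since D
   acts invertibly, O_q(M_n) embeds in its localization, and the inverse of D^l comes
   from the classical D^-1, which reduces GL_n to M_n. *)

Set Implicit Arguments.
Unset Strict Implicit.
Unset Printing Implicit Defensive.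

(** * Endomorphism algebras and power series modules *)

Section Endomorphisms.
Variable R : comNzRingType.

(* The marked nonzero vector makes the endomorphism ring nontrivial. *)
Record pmod := PMod {
  pmod_sort :> lmodType R;
  pmod_pt : pmod_sort;
  pmod_pt_neq0 : pmod_pt != 0 }.

(** Bundled so that it can carry an [algType R] structure: the universal property in [is_Oq_Mn]
    accepts only such targets. *)
Record endo (V : pmod) := Endo { endo_fun :> V -> V; endo_linear : linear endo_fun }.

Section EndoAlgebra.
Variable V : pmod.
Implicit Types f g h : endo V.

Lemma endo_eq f g : (forall v, f v = g v) -> f = g.
Proof.
case: f g => f lf [g lg] /= /funext E; case: _ / E in lg *.
by congr Endo; exact: Prop_irrelevance.
Qed.

HB.instance Definition _ := gen_eqMixin (endo V).
HB.instance Definition _ := gen_choiceMixin (endo V).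

Definition endo_zero : endo V.
Proof. by exists (fun=> 0) => a u v; rewrite scaler0 addr0. Defined.

Definition endo_opp f : endo V.
Proof.
by exists (fun v => - f v) => a u v; rewrite endo_linear opprD scalerN.
Defined.

Definition endo_add f g : endo V.
Proof.
exists (fun v => f v + g v) => a u v.
by rewrite !endo_linear scalerDr !addrA; congr (_ + _); rewrite -!addrA (addrC (f v)).
Defined.

Definition endo_one : endo V.
Proof. by exists id. Defined.

Definition endo_mul f g : endo V.
Proof. by exists (f \o g) => a u v /=; rewrite !endo_linear. Defined.

Definition endo_scale (a : R) f : endo V.
Proof.
exists (fun v => a *: f v) => b u v.
by rewrite endo_linear scalerDr !scalerA mulrC.
Defined.

Lemma endo0 f : f 0 = 0.
Proof.
by have := endo_linear f (-1) 0 0; rewrite scaler0 addr0 scaleN1r addNr.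
Qed.

Lemma endoD f u v : f (u + v) = f u + f v.
Proof. by rewrite -{1}[u]scale1r endo_linear scale1r. Qed.

Lemma endoZ f a v : f (a *: v) = a *: f v.
Proof. by rewrite -[a *: v]addr0 endo_linear endo0 addr0. Qed.

Fact endo_addA : associative endo_add.
Proof. by move=> f g h; apply: endo_eq => v /=; rewrite addrA. Qed.
Fact endo_addC : commutative endo_add.
Proof. by move=> f g; apply: endo_eq => v /=; rewrite addrC. Qed.
Fact endo_add0 : left_id endo_zero endo_add.
Proof. by move=> f; apply: endo_eq => v /=; rewrite add0r. Qed.
Fact endo_addN : left_inverse endo_zero endo_opp endo_add.
Proof. by move=> f; apply: endo_eq => v /=; rewrite addNr. Qed.

HB.instance Definition _ :=
  GRing.isZmodule.Build (endo V) endo_addA endo_addC endo_add0 endo_addN.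

Fact endo_mulA : associative endo_mul.
Proof. by move=> f g h; apply: endo_eq. Qed.
Fact endo_mul1 : left_id endo_one endo_mul.
Proof. by move=> f; apply: endo_eq. Qed.
Fact endo_mulr1 : right_id endo_one endo_mul.
Proof. by move=> f; apply: endo_eq. Qed.
Fact endo_mulDl : left_distributive endo_mul +%R.
Proof. by move=> f g h; apply: endo_eq. Qed.
Fact endo_mulDr : right_distributive endo_mul +%R.
Proof. by move=> f g h; apply: endo_eq => v /=; rewrite endoD. Qed.
Fact endo_1neq0 : endo_one != 0.
Proof.
apply/eqP => /(congr1 (fun f : endo V => f (pmod_pt V))) /= /eqP.
exact/negP/pmod_pt_neq0.
Qed.

HB.instance Definition _ := GRing.Zmodule_isNzRing.Build (endo V)
  endo_mulA endo_mul1 endo_mulr1 endo_mulDl endo_mulDr endo_1neq0.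

Fact endo_scaleA a b f : endo_scale a (endo_scale b f) = endo_scale (a * b) f.
Proof. by apply: endo_eq => v /=; rewrite scalerA. Qed.
Fact endo_scale1 : left_id 1 endo_scale.
Proof. by move=> f; apply: endo_eq => v /=; rewrite scale1r. Qed.
Fact endo_scaleDr : right_distributive endo_scale +%R.
Proof. by move=> a f g; apply: endo_eq => v /=; rewrite scalerDr. Qed.
Fact endo_scaleDl f : {morph endo_scale^~ f : a b / a + b}.
Proof. by move=> a b; apply: endo_eq => v /=; rewrite scalerDl. Qed.

HB.instance Definition _ := GRing.Zmodule_isLmodule.Build R (endo V)
  endo_scaleA endo_scale1 endo_scaleDr endo_scaleDl.

Fact endo_scaleAl (a : R) f g : a *: (f * g) = a *: f * g.
Proof. by apply: endo_eq. Qed.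

HB.instance Definition _ := GRing.Lmodule_isLalgebra.Build R (endo V) endo_scaleAl.

Fact endo_scaleAr (a : R) f g : a *: (f * g) = f * (a *: g).
Proof. by apply: endo_eq => v /=; rewrite [RHS]endoZ. Qed.

HB.instance Definition _ := GRing.Lalgebra_isAlgebra.Build R (endo V) endo_scaleAr.

Lemma endo_mulE f g v : (f * g) v = f (g v).
Proof. by []. Qed.
Lemma endo_sumE (J : Type) (s : seq J) (P : pred J) (F : J -> endo V) v :
  (\sum_(i <- s | P i) F i) v = \sum_(i <- s | P i) F i v.
Proof. by elim/big_rec2: _ => // i f u _ <-. Qed.

End EndoAlgebra.

(* Sequences in [V] model formal power series over [V] in one more variable. *)
Section Shift.
Variable V : pmod.

Fact seq_pt_neq0 : ((fun=> pmod_pt V) : nat -> V) != 0.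
Proof.
by apply/eqP => /(congr1 (@^~ 0%N)) /eqP; apply/negP; exact: pmod_pt_neq0.
Qed.

Definition seqmod := PMod seq_pt_neq0.

Definition seqlift (f : endo V) : endo seqmod.
Proof.
by exists (fun u k => f (u k)) => a u v; apply/funext => k; exact: endo_linear.
Defined.

(** On power series, multiplication by the variable. *)
Definition shift : endo seqmod.
Proof.
exists (fun u k => if k is k'.+1 then u k' else 0) => a u v.
by apply/funext => -[|k] //=; rewrite !fctE scaler0 addr0.
Defined.

(** On power series in [X], the substitution of [c X] for [X]; it commutes with [shift] up to the
    factor [c]. *)
Definition dilate (c : R) : endo seqmod.
Proof.
exists (fun u k => c ^+ k *: u k) => a u v.
by apply/funext => k; rewrite !fctE scalerDr !scalerA mulrC.
Defined.

Fact seqlift_zmod_morphism : zmod_morphism seqlift.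
Proof. by move=> f g; apply: endo_eq. Qed.
Fact seqlift_monoid_morphism : monoid_morphism seqlift.
Proof. by split=> [|f g]; apply: endo_eq. Qed.
Fact seqlift_scalable : scalable seqlift.
Proof. by move=> a f; apply: endo_eq. Qed.

HB.instance Definition _ :=
  GRing.isZmodMorphism.Build (endo V) (endo seqmod) seqlift seqlift_zmod_morphism.
HB.instance Definition _ :=
  GRing.isMonoidMorphism.Build (endo V) (endo seqmod) seqlift seqlift_monoid_morphism.
HB.instance Definition _ :=
  GRing.isScalable.Build R (endo V) (endo seqmod) *:%R seqlift seqlift_scalable.

Lemma seqlift_shiftC f : GRing.comm (seqlift f) shift.
Proof. by apply: endo_eq => u; apply/funext => -[|k] //=; rewrite endo0. Qed.

Lemma seqlift_dilateC f c : GRing.comm (seqlift f) (dilate c).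
Proof. by apply: endo_eq => u; apply/funext => k /=; rewrite endoZ. Qed.

Lemma dilate_shift c : dilate c * shift = c *: (shift * dilate c).
Proof.
apply: endo_eq => u; apply/funext => -[|k]; rewrite /= !fctE /= ?scaler0 //.
by rewrite scalerA exprS.
Qed.

Lemma dilateM c c' : dilate c * dilate c' = dilate (c * c').
Proof. by apply: endo_eq => u; apply/funext => k /=; rewrite scalerA exprMn. Qed.

Lemma dilate1 : dilate 1 = 1.
Proof. by apply: endo_eq => u; apply/funext => k /=; rewrite expr1n scale1r. Qed.

End Shift.
End Endomorphisms.

(** * Quantum matrix relations in R-matrix form *)

Section RTT.
Variables (R : comUnitRingType) (q : R) (n : nat).
Hypothesis q_unit : q \is a GRing.unit.

(* Componentwise form of the Faddeev-Reshetikhin-Takhtajan relation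
   R T_1 T_2 = T_2 T_1 R: unlike [qrel] it needs no case distinction in products. *)
Definition rtt (A : algType R) (t : 'I_n -> 'I_n -> A) := forall i j k l : 'I_n,
  q ^+ (i == j) *: (t i k * t j l)
    + (if (j < i)%N then q - q^-1 else 0) *: (t j k * t i l) =
  q ^+ (k == l) *: (t j l * t i k)
    + (if (k < l)%N then q - q^-1 else 0) *: (t j k * t i l).

Lemma qrel_rtt (A : algType R) (t : 'I_n -> 'I_n -> A) : qrel q t -> rtt t.
Proof.
case=> row col anti cross i j k l.
have qV X : (q - q^-1) *: (q *: X) = q *: (q *: X) - X :> A.
  by rewrite scalerA mulrBl mulVr // scalerBl scale1r -scalerA.
have [lij|lji|/val_inj eij] := ltngtP i j; have [lkl|llk|/val_inj ekl] := ltngtP k l;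
  rewrite -!val_eqE /= ?(ltn_eqF lij) ?(gtn_eqF lji) ?(ltn_eqF lkl) ?(gtn_eqF llk);
  rewrite ?eij ?ekl ?eqxx ?expr0 ?expr1 ?scale0r ?addr0 ?scale1r //.
- by rewrite -(anti _ _ _ _ lij lkl) -(cross _ _ _ _ lij lkl) addrC subrK.
- exact: anti lij llk.
- exact: (col _ _ _ lij).
- by rewrite (anti _ _ _ _ lji lkl).
- by rewrite -(cross _ _ _ _ lji llk) addrCA subrr addr0.
- by rewrite (col _ _ _ lji) qV addrC subrK.
- by rewrite (row _ _ _ lkl) qV addrC subrK.
- by rewrite (row _ _ _ llk).
Qed.

Lemma rtt_qrel (A : algType R) (t : 'I_n -> 'I_n -> A) : rtt t -> qrel q t.
Proof.
move=> rt; have anti (i j k l : 'I_n) :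
    (i < j)%N -> (k < l)%N -> t i l * t j k = t j k * t i l.
  move=> lij lkl; have := rt i j l k; rewrite -!val_eqE /= (ltn_eqF lij) (gtn_eqF lkl).
  by rewrite ltnNge ltnW //= ltnNge ltnW //= !scale0r !scale1r !addr0.
split=> // [i j k ljk|i h k lih|i j k l lij lkl].
(* For equal rows the relation reads [q ab = ba + (q - q^-1) ab], hence [ab = q ba]. *)
- have := rt i i j k; rewrite eqxx ltnn ljk -val_eqE /= (ltn_eqF ljk) scale0r addr0.
  rewrite !scale1r scalerBl addrCA => /eqP; rewrite eq_sym -subr_eq0 addrAC subrr add0r.
  by rewrite subr_eq0 => /eqP ->; rewrite scalerA mulrV // scale1r.
- have := rt i h k k; rewrite eqxx ltnn -val_eqE /= (ltn_eqF lih).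
  by rewrite ltnNge ltnW //= !scale0r scale1r !addr0.
- have := rt i j k l; rewrite -!val_eqE /= (ltn_eqF lij) (ltn_eqF lkl) lkl.
  rewrite ltnNge ltnW //= scale0r !scale1r addr0 => ->.
  by rewrite addrAC subrr add0r (anti _ _ _ _ lij lkl).
Qed.

Definition mulqm (A : algType R) (t s : 'I_n -> 'I_n -> A) (i k : 'I_n) : A :=
  \sum_a t i a * s a k.

(** Entries of [t] commute with those of [s], so a product of two entries of [mulqm t s] splits into
    a t-part and an s-part, and the R-matrix passes first through one and then through the other. *)
Lemma rtt_mul (A : algType R) (t s : 'I_n -> 'I_n -> A) :
  (forall i j k l, GRing.comm (t i j) (s k l)) ->
  rtt t -> rtt s -> rtt (mulqm t s).
Proof.
move=> ts rt rs i j k l.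
have UU i' j' k' l' : mulqm t s i' k' * mulqm t s j' l' =
    \sum_a \sum_b (t i' a * t j' b) * (s a k' * s b l').
  rewrite /mulqm big_distrlr /=; apply: eq_bigr => a _; apply: eq_bigr => b _.
  by rewrite -!mulrA; congr (_ * _); rewrite !mulrA ts.
have rtS a b X : q ^+ (i == j) *: (t i a * t j b * X)
      + (if (j < i)%N then q - q^-1 else 0) *: (t j a * t i b * X) =
    q ^+ (a == b) *: (t j b * t i a * X)
      + (if (a < b)%N then q - q^-1 else 0) *: (t j a * t i b * X).
  by have /(congr1 (fun Y => Y * X)) := rt i j a b; rewrite !mulrDl -!scalerAl.
have srT a b X : q ^+ (a == b) *: (X * (s a k * s b l))
      + (if (b < a)%N then q - q^-1 else 0) *: (X * (s b k * s a l)) =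
    q ^+ (k == l) *: (X * (s b l * s a k))
      + (if (k < l)%N then q - q^-1 else 0) *: (X * (s b k * s a l)).
  by have /(congr1 (fun Y => X * Y)) := rs a b k l; rewrite !mulrDr -!scalerAr.
rewrite !UU !scaler_sumr -!big_split /=.
transitivity (\sum_a \sum_b (q ^+ (a == b) *: (t j b * t i a * (s a k * s b l))
    + (if (a < b)%N then q - q^-1 else 0) *: (t j a * t i b * (s a k * s b l)))).
  apply: eq_bigr => a _; rewrite !scaler_sumr -big_split /=.
  by apply: eq_bigr => b _; rewrite rtS.
(* Only the first summand has its indices [a] and [b] exchanged; this brings the s-parts to the form
   of [srT]. *)
have swapr (F G : 'I_n -> 'I_n -> A) :
    \sum_a \sum_b (F a b + G a b) = \sum_a \sum_b (F b a + G a b).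
  transitivity (\sum_a \sum_b F a b + \sum_a \sum_b G a b).
    by rewrite -big_split; apply: eq_bigr => a _; rewrite big_split.
  rewrite exchange_big -big_split /=; apply: eq_bigr => a _.
  by rewrite -big_split.
rewrite swapr; apply: eq_bigr => a _.
rewrite !scaler_sumr -big_split /=; apply: eq_bigr => b _.
by rewrite [b == a]eq_sym -srT eq_sym.
Qed.

End RTT.

(** * Gaussian binomials and powers of q-commuting sums *)

Section FrobeniusSum.
Variables (R : comNzRingType) (w : R).

(** Gaussian binomial coefficients, given by their Pascal rule so that no division by [1 - w ^+ k]
    occurs. *)
Fixpoint gauss (m k : nat) : R :=
  match m, k with
  | 0, 0 => 1
  | 0, _.+1 => 0
  | m'.+1, 0 => 1
  | m'.+1, k'.+1 => w ^+ k * gauss m' k + gauss m' k'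
  end.

Arguments gauss : simpl never.

Lemma gaussn0 m : gauss m 0 = 1. Proof. by case: m. Qed.

Lemma gaussS m k : gauss m.+1 k.+1 = w ^+ k.+1 * gauss m k.+1 + gauss m k.
Proof. by []. Qed.

Lemma gauss_small m k : (m < k)%N -> gauss m k = 0.
Proof.
elim: m k => [|m IHm] [|k] // ltmk.
by rewrite gaussS !IHm ?mulr0 ?addr0 // ltnW.
Qed.

Lemma gaussnn m : gauss m m = 1.
Proof. by elim: m => // m IHm; rewrite gaussS IHm gauss_small // mulr0 add0r. Qed.

(** Analogue of [k C(m,k) = m C(m-1,k-1)], free of denominators. The Pascal step also needs a
    relation between [gauss m k] and [gauss m.+1 k], so both identities are proved in one
    induction. *)
Lemma gauss_absorb m k :
  (1 - w ^+ k.+1) * gauss m.+1 k.+1 = (1 - w ^+ m.+1) * gauss m k.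
Proof.
suff [] : (forall k, (1 - w ^+ k.+1) * gauss m.+1 k.+1 = (1 - w ^+ m.+1) * gauss m k)
    /\ (forall k, w ^+ k * (1 - w ^+ m.+1) * gauss m k =
          (w ^+ k - w ^+ m.+1) * gauss m.+1 k) by [].
elim: m {k} => [|m [IH1 IH2]].
  have P0 k : (1 - w ^+ k.+1) * gauss 1 k.+1 = (1 - w ^+ 1) * gauss 0 k.
    by case: k => [|k]; rewrite gaussS /= ?mulr0 ?add0r ?mulr1 ?mulr0.
  split=> // -[|k]; first by rewrite !gaussn0 expr0 mul1r.
  rewrite [RHS](_ : _ = (1 - w ^+ 1) * gauss 1 k.+1 - (1 - w ^+ k.+1) * gauss 1 k.+1).
    by rewrite P0 gaussS; ring.
  by ring.
have P k : (1 - w ^+ k.+1) * gauss m.+2 k.+1 = (1 - w ^+ m.+2) * gauss m.+1 k.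
  rewrite gaussS mulrDr mulrCA IH1.
  rewrite [X in X + _](_ : _ = w * (w ^+ k * (1 - w ^+ m.+1) * gauss m k)).
    rewrite IH2 !exprS. ring.
  by rewrite !exprS; ring.
split=> // -[|k]; first by rewrite !gaussn0 expr0 mul1r.
rewrite [RHS](_ : _ =
    (1 - w ^+ m.+2) * gauss m.+2 k.+1 - (1 - w ^+ k.+1) * gauss m.+2 k.+1).
  by rewrite P [gauss m.+2 _]gaussS; ring.
by ring.
Qed.

Variables (A : algType R) (u v : A).
Hypothesis uvC : u * v = w *: (v * u).

(** The q-binomial theorem: moving [u] past [v ^+ k] costs [w ^+ k], which is the weight in the
    Pascal rule. *)
Lemma exprD_qcomm m :
  (u + v) ^+ m = \sum_(k < m.+1) gauss m k *: (v ^+ k * u ^+ (m - k)).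
Proof.
have uvX k : u * v ^+ k = w ^+ k *: (v ^+ k * u).
  elim: k => [|k IHk]; first by rewrite !expr0 scale1r mulr1 mul1r.
  rewrite [v ^+ _]exprSr mulrA IHk -scalerAl -(mulrA _ u) uvC -scalerAr scalerA.
  by rewrite (mulrA _ v) -!exprSr.
elim: m => [|m IHm]; first by rewrite big_ord1 !expr0 scale1r mulr1.
rewrite exprS IHm mulrDl !mulr_sumr [RHS]big_ord_recl.
under [in RHS]eq_bigr => k _ do rewrite gaussS scalerDl.
rewrite big_split /= addrA; congr (_ + _); last first.
  by apply: eq_bigr => k _; rewrite -scalerAr mulrA -exprS /bump add1n subSS.
(* [G] joins the [k = 0] term to the first Pascal summand; its last value, at [k = m.+1],
   vanishes. *)
pose G k := (w ^+ k * gauss m k) *: (v ^+ k * u ^+ (m.+1 - k)).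
rewrite [RHS](_ : _ = \sum_(k < m.+2) G k); last first.
  by rewrite [RHS]big_ord_recl /G /= !expr0 !mul1r !gaussn0.
rewrite [RHS]big_ord_recr /= {2}/G gauss_small // mulr0 scale0r addr0.
apply: eq_bigr => k _; rewrite -scalerAr mulrA uvX -scalerAl scalerA mulrC /G.
by rewrite -mulrA -exprS subSn // -ltnS.
Qed.

(** By [gauss_absorb] each inner coefficient times the nonzero [1 - w ^+ k] is a multiple of
    [1 - w ^+ l = 0], so without zero divisors it vanishes. *)
Lemma exprD_root_of_unity l :
  (forall x y : R, x * y = 0 -> x = 0 \/ y = 0) ->
  (0 < l)%N -> w ^+ l = 1 -> (forall k, (0 < k < l)%N -> w ^+ k <> 1) ->
  (u + v) ^+ l = u ^+ l + v ^+ l.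
Proof.
move=> domR; case: l => // l _ wl wk.
rewrite exprD_qcomm big_ord_recl big_ord_recr /= gaussn0 scale1r expr0 mul1r subn0.
rewrite big1 ?add0r => [|[i lti] _].
  by rewrite /bump /= add1n subnn gaussnn scale1r expr0 mulr1.
rewrite /bump /= add1n.
suff -> : gauss l.+1 i.+1 = 0 by rewrite scale0r.
have /domR[/eqP|//] : (1 - w ^+ i.+1) * gauss l.+1 i.+1 = 0.
  by rewrite gauss_absorb wl subrr mul0r.
by rewrite subr_eq0 eq_sym => /eqP wi; case: (wk i.+1 _ wi).
Qed.
End FrobeniusSum.

(** * Ordered products and lengths of permutations *)

Section NoncommutativeProducts.
Variable A : nzRingType.

Lemma prod_commM (I : Type) (s : seq I) (f g : I -> A) :
  (forall i j, GRing.comm (f i) (g j)) ->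
  \prod_(i <- s) (f i * g i) = \prod_(i <- s) f i * \prod_(i <- s) g i.
Proof.
move=> fg; elim: s => [|i s IHs]; first by rewrite !big_nil mulr1.
rewrite !big_cons IHs -!mulrA; congr (_ * _); rewrite !mulrA; congr (_ * _).
apply: commr_prod => j _; exact/commr_sym/fg.
Qed.

Lemma prod_update (I : eqType) (s : seq I) (i0 : I) (F G H : I -> A) :
  uniq s -> i0 \in s -> F i0 = G i0 + H i0 ->
  (forall i, i != i0 -> F i = G i) -> (forall i, i != i0 -> F i = H i) ->
  \prod_(i <- s) F i = \prod_(i <- s) G i + \prod_(i <- s) H i.
Proof.
move=> us i0s F0 FG FH.
have notin s' P : i0 \notin s' -> (forall i, i != i0 -> F i = P i) ->
    \prod_(i <- s') F i = \prod_(i <- s') P i.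
  by move=> ni FP; apply: eq_big_seq => i si; apply: FP; apply: contraNneq ni => <-.
elim: s us i0s => // i s IHs /= /andP[nis us]; rewrite inE !big_cons.
have [E _|ne /= si0] := eqVneq i0 i.
  rewrite -{}E in nis *.
  by rewrite F0 mulrDl -(notin _ G) // -(notin _ H).
by rewrite IHs // mulrDr {1}FG 1?FH // 1?eq_sym.
Qed.

(** The two surviving factors stand in the order of their indices; this matters in
    [qdet_elementary], where [ka] and [x] only q-commute. *)
Lemma prod_ord2 (n : nat) (i j : 'I_n) (F : 'I_n -> A) :
  (i < j)%N -> (forall k, k != i -> k != j -> F k = 1) ->
  \prod_(k < n) F k = F i * F j.
Proof.
move=> ltij F1.
have E : [seq k <- index_enum 'I_n | (k == i) || (k == j)] = [:: i; j].
  apply: (@irr_sorted_eq _ (fun k m : 'I_n => (k < m)%N)) => [k m p|k|||k].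
  - exact: ltn_trans.
  - exact: ltnn.
  - apply: sorted_filter => [k m p|]; first exact: ltn_trans.
    have := iota_ltn_sorted 0 n; rewrite -val_enum_ord sorted_map.
    by rewrite [index_enum _]unlock enumT.
  - by rewrite /= ltij.
  - by rewrite mem_filter mem_index_enum andbT !inE.
transitivity (\prod_(k <- index_enum 'I_n | (k == i) || (k == j)) F k).
  rewrite [RHS]big_mkcond /=; apply: eq_bigr => k _.
  by case: ifP => // /negbT; rewrite negb_or => /andP[ki kj]; exact: F1.
by rewrite -big_filter E !big_cons big_nil mulr1.
Qed.
End NoncommutativeProducts.

(** Exchanging neighbouring values does not affect how either compares with a third value, so the
    inversion set only gains the pair of positions of [a] and [b]. *)
Lemma perm_length_tperm (n : nat) (a b : 'I_n) (s : 'S_n) :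
  b = a.+1 :> nat -> ((s^-1)%g a < (s^-1)%g b)%N ->
  perm_length (s * tperm a b)%g = (perm_length s).+1.
Proof.
move=> ba lt_ab; rewrite /perm_length.
set r1 := (s^-1)%g a in lt_ab *; set r2 := (s^-1)%g b in lt_ab *.
have nin : (r1, r2) \notin [set p : 'I_n * 'I_n | (p.1 < p.2)%N && (s p.2 < s p.1)%N].
  by rewrite inE /= !permKV ba [X in _ && X]ltnNge leqnSn andbF.
rewrite -(add1n #|_|) -[X in (X + _)%N]/(nat_of_bool true) -[true]nin -cardsU1.
apply: eq_card => -[p1 p2]; rewrite !inE /= !permM.
have E p c : (p == (s^-1)%g c) = (s p == c :> nat).
  by rewrite val_eqE (canF_eq (permK s)).
have H1 : (s p1 == a :> nat) && (s p2 == b :> nat) ==> (p1 < p2)%N.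
  by rewrite -!E; apply/implyP => /andP[/eqP -> /eqP ->].
have H2 : (s p1 == b :> nat) && (s p2 == a :> nat) ==> (p2 < p1)%N.
  by rewrite -!E; apply/implyP => /andP[/eqP -> /eqP ->].
rewrite xpair_eqE !E; move: (s p1) (s p2) H1 H2 => y1 y2.
case: (tpermP a b y2) => [->|->|/eqP + /eqP +];
  case: (tpermP a b y1) => [->|->|/eqP + /eqP +]; rewrite -?val_eqE /=; lia.
Qed.

Lemma adjacent_neq (n : nat) (a b : 'I_n) :
  (b == a.+1 :> nat) || (a == b.+1 :> nat) -> a != b.
Proof. by rewrite -val_eqE /=; lia. Qed.

(** * Quantum determinant under an elementary column operation *)

Section QdetElementary.
Variables (R : comUnitRingType) (q : R) (n : nat) (A : algType R).
Variables (t t' : 'I_n -> 'I_n -> A) (a b : 'I_n) (ka kb x : A).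
Hypothesis adj : (b == a.+1 :> nat) || (a == b.+1 :> nat).
Hypothesis tka : forall i j, GRing.comm (t i j) ka.
Hypothesis tkb : forall i j, GRing.comm (t i j) kb.
Hypothesis tx : forall i j, GRing.comm (t i j) x.
Hypothesis kab : ka * kb = 1.
Hypothesis kba : kb * ka = 1.
Hypothesis kax :
  if (a < b)%N then ka * x = q *: (x * ka) else x * ka = q *: (ka * x).
Hypothesis t'a : forall r, t' r a = t r a * ka.
Hypothesis t'b : forall r, t' r b = t r b * kb + t r a * x.
Hypothesis t'c : forall r c, c != a -> c != b -> t' r c = t r c.

Let neq_ab : a != b := adjacent_neq adj.

(* The extra terms cancel in pairs [s], [s * tperm a b]. *)
Lemma qdet_elementary : qdet q t' = qdet q t.
Proof.
(* Column [b] of [t'] has two summands. The first gives the factors [k]; the second gives the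
   factors [h] and the column map [m], under which column [a] occurs twice. *)
pose k c : A := if c == a then ka else if c == b then kb else 1.
pose h c : A := if c == b then x else if c == a then ka else 1.
pose m (s : 'S_n) r := if s r == b then a else s r.
pose P (s : 'S_n) := ((s^-1)%g a < (s^-1)%g b)%N.
have two (s : 'S_n) (g : 'I_n -> A) : (forall c, c != a -> c != b -> g c = 1) ->
    \prod_(r < n) g (s r) = if P s then g a * g b else g b * g a.
  move=> g1.
  have [ge|lt] := ltnP ((s^-1)%g a) ((s^-1)%g b); rewrite /P.
    rewrite ge (prod_ord2 ge) ?permKV // => r ra rb.
    by apply: g1; [apply: contra ra|apply: contra rb] => /eqP <-; rewrite permK.
  have {}lt : ((s^-1)%g b < (s^-1)%g a)%N.
    by rewrite ltn_neqAle lt andbT val_eqE (inj_eq perm_inj) eq_sym.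
  rewrite ltnNge ltnW //= (prod_ord2 lt) ?permKV // => r ra rb.
  by apply: g1; [apply: contra rb|apply: contra ra] => /eqP <-; rewrite permK.
have expand (s : 'S_n) : \prod_(r < n) t' r (s r) = \prod_(r < n) t r (s r)
    + (\prod_(r < n) t r (m s r)) * (if P s then ka * x else x * ka).
  rewrite (@prod_update _ _ _ ((s^-1)%g b) _ (fun r => t r (s r) * k (s r))
    (fun r => t r (m s r) * h (s r))) ?index_enum_uniq ?mem_index_enum //; first last.
  - move=> r rb; rewrite /m /h.
    have sb : s r != b by apply: contra rb => /eqP <-; rewrite permK.
    rewrite (negbTE sb); case: eqVneq => [->|sa]; first exact: t'a.
    by rewrite mulr1 t'c.
  - move=> r rb; rewrite /k.
    have sb : s r != b by apply: contra rb => /eqP <-; rewrite permK.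
    rewrite (negbTE sb); case: eqVneq => [->|sa]; first exact: t'a.
    by rewrite mulr1 t'c.
  - by rewrite /k /m /h permKV eqxx eq_sym (negbTE neq_ab) t'b.
  rewrite !prod_commM; first last.
  - by move=> i j; rewrite /k; case: ifP => _ //; case: ifP => _ //; exact: commr1.
  - by move=> i j; rewrite /h; case: ifP => _ //; case: ifP => _ //; exact: commr1.
  rewrite !two; first last.
  - by move=> c ca cb; rewrite /k (negbTE ca) (negbTE cb).
  - by move=> c ca cb; rewrite /h (negbTE ca) (negbTE cb).
  rewrite /k /h !eqxx (negbTE neq_ab) eq_sym (negbTE neq_ab) kab kba if_same.
  by rewrite mulr1.
rewrite /qdet; under eq_bigr => s _ do rewrite expand scalerDr.
rewrite big_split /= -[RHS]addr0; congr (_ + _).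
(* Multiplication by [tperm a b] exchanges [P] with its complement, keeps the columns [m s] and
   changes the length by one; [kax] then makes the two terms cancel. *)
rewrite (bigID P) /= [X in _ + X](reindex_inj (mulIg (tperm a b))) /=.
have Ps s : P (s * tperm a b)%g = ~~ P s.
  rewrite /P invMg tpermV !permM tpermL tpermR -leqNgt ltn_neqAle val_eqE.
  by rewrite (inj_eq perm_inj) eq_sym neq_ab.
under [X in _ + X]eq_bigl => s do rewrite Ps negbK.
rewrite -big_split /= big1 // => s Ps'.
rewrite Ps Ps' /=.
have -> : \prod_(r < n) t r (m (s * tperm a b)%g r) = \prod_(r < n) t r (m s r).
  apply: eq_bigr => r _; congr (t r _); rewrite /m permM.
  by case: tpermP => [->|->|/eqP na /eqP nb]; rewrite ?eqxx ?(negbTE neq_ab).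
set W := \prod_(r < n) _; rewrite 2!(scalerAr _ W) -mulrDr.
suff -> : (- q) ^+ perm_length s *: (ka * x)
    + (- q) ^+ perm_length (s * tperm a b)%g *: (x * ka) = 0 by rewrite mulr0.
case/orP: adj => /eqP e; move: kax; rewrite e ?ltnS ?leqnn ?ltnNge ?leqnSn /= => kx.
- by rewrite perm_length_tperm // kx !exprS !scalerA mulNr mulrC scaleNr addrN.
- have := @perm_length_tperm _ b a (s * tperm a b)%g e.
  rewrite [tperm b a]tpermC -mulgA tperm2 mulg1 => ->; last first.
    by rewrite invMg tpermV !permM tpermL tpermR.
  by rewrite kx exprS !scalerA mulNr mulrC scaleNr addNr.
Qed.
End QdetElementary.

(** * Elementary quantum matrices *)

Section ElementaryMatrix.
Variables (R : comUnitRingType) (q : R) (n : nat) (A : algType R).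
Variables (a b : 'I_n) (ka kb x : A).
Hypothesis q_unit : q \is a GRing.unit.
Hypothesis adj : (b == a.+1 :> nat) || (a == b.+1 :> nat).
Hypothesis kab : ka * kb = 1.
Hypothesis kba : kb * ka = 1.
Hypothesis kax :
  if (a < b)%N then ka * x = q *: (x * ka) else x * ka = q *: (ka * x).

(** A triangular quantum 2 by 2 block of quantum determinant [ka * kb = 1], completed by the
    identity; it is upper triangular if [a < b] and lower triangular otherwise. *)
Definition elem_mx (i j : 'I_n) : A :=
  if i == j then (if i == a then ka else if i == b then kb else 1)
  else if (i == a) && (j == b) then x else 0.

Let elem_kbx :
  if (a < b)%N then x * kb = q *: (kb * x) else kb * x = q *: (x * kb).
Proof.
case: ifP kax => _ kx.
  have /(congr1 (fun y => kb * (y * kb))) := kx.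
  by rewrite !mulrA kba mul1r -scalerAr -scalerAl -!mulrA kab mulr1.
have /(congr1 (fun y => kb * (y * kb))) := kx.
by rewrite -!mulrA kab mulr1 -scalerAl -scalerAr !mulrA kba mul1r.
Qed.

(** No diagonal entry lies strictly between the adjacent [a] and [b], so the antidiagonal of every 2
    by 2 minor contains a zero ([anti]). The cross relation thus reduces to commutation of the main
    diagonal entries; the row and column relations reduce to [kax] and [elem_kbx]. *)
Lemma rtt_elem_mx : rtt q elem_mx.
Proof.
have ne := adjacent_neq adj.
have anti (i j k m : 'I_n) : (i < j)%N -> (k < m)%N ->
    elem_mx i m = 0 \/ elem_mx j k = 0.
  move=> lij lkm; rewrite /elem_mx -!val_eqE /=.
  case: (i =P m :> nat) => im; last first.
    case: ifP => iam; last by left.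
    by right; case: ifP; [lia|case: ifP => //; lia].
  by right; case: ifP; [lia|case: ifP => //; move: adj; lia].
apply: qrel_rtt => //; split=> [i j k ljk|i h k lih|i j k m lij lkm|i j k m lij lkm].
- rewrite /elem_mx; have jk : j != k by rewrite -val_eqE /= ltn_eqF.
  case: (eqVneq i j) => [ij|ij]; case: (eqVneq i k) => [ik|ik];
    rewrite ?mulr0 ?mul0r ?scaler0 //.
  + by rewrite -ij ik eqxx in jk.
  + case: (eqVneq i a) => [ia|_]; last by rewrite mulr0 mul0r scaler0.
    case: (eqVneq k b) => [kb'|_]; last by rewrite mulr0 mul0r scaler0.
    by move: kax; rewrite -ia -kb' ij ljk.
  + case: (eqVneq i a) => [ia|_]; last by rewrite mulr0 mul0r scaler0.
    case: (eqVneq j b) => [jb|_]; last by rewrite mulr0 mul0r scaler0.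
    by move: kax; rewrite -ia -jb ik ltnNge ltnW.
  + case: (eqVneq i a) => [ia|_]; last by rewrite mulr0 scaler0.
    case: (eqVneq j b) => [jb|_]; last by rewrite mulr0 mul0r scaler0.
    by rewrite -jb eq_sym (negbTE jk) mulr0 mul0r scaler0.
- rewrite /elem_mx; have ih : i != h by rewrite -val_eqE /= ltn_eqF.
  case: (eqVneq i k) => [ik|ik]; case: (eqVneq h k) => [hk|hk];
    rewrite ?mulr0 ?mul0r ?scaler0 //.
  + by rewrite ik hk eqxx in ih.
  + case: (eqVneq h a) => [ha|_]; last by rewrite mulr0 mul0r scaler0.
    case: (eqVneq k b) => [kb'|_]; last by rewrite mulr0 mul0r scaler0.
    move: elem_kbx; rewrite -ha -kb' -ik ltnNge ltnW //.
    by rewrite (negbTE ih) eqxx.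
  + case: (eqVneq i a) => [ia|_]; last by rewrite mulr0 mul0r scaler0.
    case: (eqVneq k b) => [kb'|_]; last by rewrite mulr0 mul0r scaler0.
    by move: elem_kbx; rewrite -ia -kb' -hk lih [h == i]eq_sym (negbTE ih) eqxx.
  + case: (eqVneq i a) => [ia|_]; last by rewrite mul0r mulr0 scaler0.
    by rewrite -ia [h == i]eq_sym (negbTE ih) mul0r mulr0 scaler0.
- by case: (anti _ _ _ _ lij lkm) => ->; rewrite ?mulr0 ?mul0r.
- have -> : elem_mx i m * elem_mx j k = 0.
    by case: (anti _ _ _ _ lij lkm) => ->; rewrite ?mulr0 ?mul0r.
  apply/eqP; rewrite scaler0 subr_eq0; apply/eqP; rewrite /elem_mx.
  case: (eqVneq i k) => [ik|ik]; case: (eqVneq j m) => [jm|jm];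
    rewrite ?mulr0 ?mul0r //.
  + by case: (i == a); case: (i == b); case: (j == a); case: (j == b); rewrite ?mulr1 ?mul1r ?kab ?kba.
  + case: (boolP ((j == a) && (m == b))) => [/andP[/eqP ja /eqP mb]|_];
      last by rewrite mulr0 mul0r.
    case: eqP => [ia|_]; first by move: lij; rewrite ia ja ltnn.
    case: eqP => [ib|_]; last by rewrite mulr1 mul1r.
    by move: lkm; rewrite -ik ib mb ltnn.
  + case: (boolP ((i == a) && (k == b))) => [/andP[/eqP ia /eqP kb']|_];
      last by rewrite mulr0 mul0r.
    case: eqP => [ja|_]; first by move: lij; rewrite ia ja ltnn.
    case: eqP => [jb|_]; last by rewrite mulr1 mul1r.
    by move: lkm; rewrite -jm kb' jb ltnn.
  + case: ifP => [/andP[/eqP ia _]|]; last by rewrite mulr0 mul0r.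
    case: ifP => [/andP[/eqP ja _]|]; last by rewrite mulr0 mul0r.
    by move: lij; rewrite ia ja ltnn.
Qed.

Lemma mulqm_elem_mx (t : 'I_n -> 'I_n -> A) r c : mulqm t elem_mx r c =
  if c == a then t r a * ka else if c == b then t r b * kb + t r a * x else t r c.
Proof.
have ne := adjacent_neq adj.
rewrite /mulqm (bigD1 c) //= /elem_mx eqxx.
have [->|ca] := eqVneq c a.
  rewrite big1 ?addr0 // => d da; rewrite (negbTE da) (negbTE ne) andbF.
  by rewrite mulr0.
have [->|cb] := eqVneq c b.
  congr (_ + _); rewrite (bigD1 a) //= (negbTE ne) !eqxx big1 ?addr0 //.
  by move=> d /andP[/negbTE -> /negbTE ->]; rewrite mulr0.
rewrite mulr1 big1 ?addr0 // => d /negbTE ->.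
by rewrite andbF mulr0.
Qed.
End ElementaryMatrix.

(** * Words in the matrix entries *)

Definition word (A : nzRingType) (n : nat) (t : 'I_n -> 'I_n -> A)
  (w : seq ('I_n * 'I_n)) : A := \prod_(p <- w) t p.1 p.2.

Lemma word_cat (A : nzRingType) (n : nat) (t : 'I_n -> 'I_n -> A) w1 w2 :
  word t (w1 ++ w2) = word t w1 * word t w2.
Proof. by rewrite /word big_cat. Qed.

Lemma word_cons (A : nzRingType) (n : nat) (t : 'I_n -> 'I_n -> A) p w :
  word t (p :: w) = t p.1 p.2 * word t w.
Proof. by rewrite /word big_cons. Qed.

Lemma perm_eq_count_mem (T : eqType) (s1 s2 : seq T) :
  (forall x, count_mem x s1 = count_mem x s2) -> perm_eq s1 s2.
Proof. by move=> E; apply/allP => x _ /=; rewrite E. Qed.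

(** No two words of the family may be permutations of one another, but the order of letters within
    each word is free, which lets the notion pass through a relabelling of letters. *)
Definition indep_words (R : comUnitRingType) (A : algType R) (n : nat)
    (t : 'I_n -> 'I_n -> A) (S : pred ('I_n * 'I_n)) : Prop :=
  forall (J : finType) (P : pred J) (w : J -> seq ('I_n * 'I_n)) (c : J -> R),
    (forall j, P j -> all S (w j)) ->
    (forall j j', P j -> P j' -> perm_eq (w j) (w j') -> j = j') ->
    \sum_(j | P j) c j *: word t (w j) = 0 -> forall j, P j -> c j = 0.

Lemma qdet_morph (R : comUnitRingType) (q : R) (n : nat) (A B : algType R)
    (f : {lrmorphism A -> B}) (t : 'I_n -> 'I_n -> A) :
  f (qdet q t) = qdet q (fun i j => f (t i j)).
Proof.
rewrite /qdet linear_sum; apply: eq_bigr => s _.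
by rewrite linearZ /= rmorph_prod.
Qed.

Lemma invertible_rmorph (A B : nzRingType) (f : {rmorphism A -> B}) (x : A) :
  invertible x -> invertible (f x).
Proof. by case=> y [xy yx]; exists (f y); rewrite -!rmorphM xy yx rmorph1. Qed.

(** * Representations and their enlargement by one matrix position *)

Section Models.
Variables (R : comUnitRingType) (q : R) (l n : nat).
Hypothesis domR : forall x y : R, x * y = 0 -> x = 0 \/ y = 0.
Hypothesis q_unit : q \is a GRing.unit.
Hypothesis q_prim : l.-primitive_root q.
Hypothesis l_odd : odd l.

(** [S] contains the positions whose entries may be nonzero. The remaining fields are chosen to
    survive multiplication by one elementary matrix and, once [S] is everything, to transfer to the
    quantum algebra. *)
Record is_model (V : pmod R) (T : 'I_n -> 'I_n -> endo V)
    (S : pred ('I_n * 'I_n)) : Prop := IsModel {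
  model_rtt : rtt q T;
  model_supp : forall i j, ~~ S (i, j) -> T i j = 0;
  model_indep : indep_words T S;
  model_central : forall i j k m, GRing.comm (T i j ^+ l) (T k m);
  model_qdetC : forall i j, GRing.comm (qdet q T) (T i j);
  model_qdetU : invertible (qdet q T);
  model_qdetX : qdet 1 (fun i j => T i j ^+ l) = qdet q T ^+ l }.

Let l_gt0 : (0 < l)%N. Proof. by case: l l_odd. Qed.

Section Step.
Variables (V : pmod R) (T : 'I_n -> 'I_n -> endo V) (S : pred ('I_n * 'I_n)).
Hypothesis TS : is_model T S.
Variables (a b r0 : 'I_n).
Hypothesis adj : (b == a.+1 :> nat) || (a == b.+1 :> nat).
Hypothesis Sb : ~~ S (r0, b).
Hypothesis Sa : S (r0, a).
Hypothesis Sab : forall r, S (r, a) -> r = r0 \/ S (r, b).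

(** [dilate_shift] yields the factor [kappa]; [kax] requires it to be [q] or [q^-1] according to the
    orientation. *)
Let kappa : R := if (a < b)%N then q else q^-1.
Let ka : endo (seqmod V) := dilate V kappa.
Let kb : endo (seqmod V) := dilate V kappa^-1.
Let x : endo (seqmod V) := shift V.
Let T0 i j : endo (seqmod V) := seqlift (T i j).
(** Column [b] becomes column [b] times [kb] plus column [a] times [x]; by [Sab] the only position
    this adds to the support is [(r0, b)]. *)
Let T1 := mulqm T0 (elem_mx a b ka kb x).

Let kappa_unit : kappa \is a GRing.unit.
Proof. by rewrite /kappa; case: ifP; rewrite ?unitrV. Qed.

Let kappa_prim : l.-primitive_root kappa.
Proof.
rewrite /kappa; case: ifP => // _.
have -> : q^-1 = q ^+ l.-1.
  apply: (mulrI q_unit); rewrite mulrV // -exprS prednK //.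
  by rewrite (prim_expr_order q_prim).
have := exp_prim_root q_prim l.-1.
by have /eqP -> := coprimePn l_gt0; rewrite divn1.
Qed.

Let kab : ka * kb = 1.
Proof. by rewrite dilateM mulrV // dilate1. Qed.
Let kba : kb * ka = 1.
Proof. by rewrite dilateM mulVr // dilate1. Qed.

Let kax :
  if (a < b)%N then ka * x = q *: (x * ka) else x * ka = q *: (ka * x).
Proof.
rewrite /ka /x dilate_shift /kappa; case: (a < b)%N => //.
by rewrite scalerA mulrV // scale1r.
Qed.

Let T0C i j k m : GRing.comm (T0 i j) (elem_mx a b ka kb x k m).
Proof.
rewrite /elem_mx /ka /kb /x.
by do !case: ifP => _; rewrite /T0;
  [exact: seqlift_dilateC|exact: seqlift_dilateC|exact: commr1
  |exact: seqlift_shiftC|exact: commr0].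
Qed.

Let T1E r c : T1 r c =
  if c == a then T0 r a * ka else if c == b then T0 r b * kb + T0 r a * x else T0 r c.
Proof. by rewrite /T1 mulqm_elem_mx. Qed.

Let rtt_T0 : rtt q T0.
Proof.
move=> i j k m; have /(congr1 (@seqlift R V)) := model_rtt TS i j k m.
by rewrite !raddfD /= !linearZ /= !rmorphM.
Qed.

Let rtt_T1 : rtt q T1.
Proof. by apply: rtt_mul => //; exact: rtt_elem_mx. Qed.

Let T0ab r : T0 r a * T0 r b = kappa *: (T0 r b * T0 r a).
Proof.
have [row _ _ _] := rtt_qrel q_unit rtt_T0.
rewrite /kappa; case: ifP => lab; first exact: row.
have lba : (b < a)%N by move: adj lab; lia.
by rewrite [in RHS]row // scalerA mulVr // scale1r.
Qed.

Let dilateX c m : dilate V c ^+ m = dilate V (c ^+ m).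
Proof.
elim: m => [|m IHm]; first by rewrite !expr0 dilate1.
by rewrite exprS IHm dilateM -exprS.
Qed.

Let kaX : ka ^+ l = 1.
Proof. by rewrite dilateX (prim_expr_order kappa_prim) dilate1. Qed.
Let kbX : kb ^+ l = 1.
Proof. by rewrite dilateX exprVn (prim_expr_order kappa_prim) invr1 dilate1. Qed.

Let dilate_shiftX c m : dilate V c * x ^+ m = c ^+ m *: (x ^+ m * dilate V c).
Proof.
elim: m => [|m IHm]; first by rewrite !expr0 scale1r mulr1 mul1r.
rewrite [x ^+ _]exprSr mulrA IHm -scalerAl -(mulrA _ (dilate V c)) dilate_shift.
by rewrite -scalerAr scalerA (mulrA _ x) -!exprSr.
Qed.

(** In column [b] the two summands commute up to [kappa^-1 ^+ 2]: one factor comes from [kb] and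
    [x], the other from the row relation. As [l] is odd, this square is again a primitive [l]-th
    root of unity, and the power of the sum splits. *)
Let T1X r c : T1 r c ^+ l = if c == b then T0 r b ^+ l + T0 r a ^+ l * x ^+ l
                            else T0 r c ^+ l.
Proof.
have ne := adjacent_neq adj.
have T0k r' c' k : GRing.comm (T0 r' c') (dilate V k) by exact: seqlift_dilateC.
have T0x r' c' : GRing.comm (T0 r' c') x by exact: seqlift_shiftC.
rewrite T1E; case: (eqVneq c b) => [->|cb].
  rewrite eq_sym (negbTE ne).
  have uv : (T0 r b * kb) * (T0 r a * x)
      = (kappa^-1 ^+ 2) *: ((T0 r a * x) * (T0 r b * kb)).
    rewrite !mulrA -(mulrA _ kb) -T0k mulrA -(mulrA _ kb) dilate_shift.
    rewrite -(mulrA _ x) -T0x !mulrA T0ab -!scalerAl -!scalerAr.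
    by rewrite !scalerA expr2 -mulrA mulVr // mulr1 !mulrA.
  rewrite (exprD_root_of_unity uv domR l_gt0).
  - by rewrite (exprMn_comm _ (T0k _ _ _)) (exprMn_comm _ (T0x _ _)) kbX mulr1.
  - by rewrite exprAC exprVn (prim_expr_order kappa_prim) invr1 expr1n.
  - move=> k kl; rewrite -exprM exprVn => /(congr1 GRing.inv).
    rewrite invrK invr1 => /eqP; rewrite -(prim_order_dvd kappa_prim).
    rewrite Gauss_dvdr ?coprimen2 // => /dvdn_leq; lia.
case: eqP => [->|_] //.
by rewrite (exprMn_comm _ (T0k _ _ _)) kaX mulr1.
Qed.

(** By [T1X] everything reduces to [l]-th powers of entries of [T0] and to [x ^+ l], which commutes
    with the dilations because [kappa ^+ l = 1]. *)
Let T1_central i j k m : GRing.comm (T1 i j ^+ l) (T1 k m).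
Proof.
have C0 r c r' c' : GRing.comm (T0 r c ^+ l) (T0 r' c').
  by rewrite /T0 -rmorphXn /GRing.comm -!rmorphM (model_central TS).
have Ck r c k' : GRing.comm (T0 r c ^+ l) (dilate V k').
  by rewrite /T0 -rmorphXn; exact: seqlift_dilateC.
have Cx r c : GRing.comm (T0 r c ^+ l) x.
  by rewrite /T0 -rmorphXn; exact: seqlift_shiftC.
have xT r c : GRing.comm (x ^+ l) (T0 r c).
  by apply/commr_sym/commrX; exact: seqlift_shiftC.
have xk k' : k' ^+ l = 1 -> GRing.comm (x ^+ l) (dilate V k').
  by move=> kl; rewrite /GRing.comm dilate_shiftX kl scale1r.
have kl : kappa ^+ l = 1 by exact: prim_expr_order.
have kVl : kappa^-1 ^+ l = 1 by rewrite exprVn kl invr1.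
have xx : GRing.comm (x ^+ l) x by apply/commr_sym/commrX.
have CD (y y' z : endo (seqmod V)) :
    GRing.comm y z -> GRing.comm y' z -> GRing.comm (y + y') z.
  by move=> yz y'z; apply: commr_sym; apply: commrD; exact: commr_sym.
have CM (y y' z : endo (seqmod V)) :
    GRing.comm y z -> GRing.comm y' z -> GRing.comm (y * y') z.
  by move=> yz y'z; apply: commr_sym; apply: commrM; exact: commr_sym.
suff C z : (forall r c, GRing.comm z (T0 r c)) -> GRing.comm z ka ->
    GRing.comm z kb -> GRing.comm z x -> GRing.comm z (T1 k m).
  rewrite T1X; case: (j == b); apply: C.
  - by move=> r c; apply: CD; [exact: C0|apply: CM; [exact: C0|exact: xT]].
  - by apply: CD; [exact: Ck|apply: CM; [exact: Ck|exact: xk]].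
  - by apply: CD; [exact: Ck|apply: CM; [exact: Ck|exact: xk]].
  - by apply: CD; [exact: Cx|apply: CM; [exact: Cx|exact: xx]].
  - by move=> r c; exact: C0.
  - exact: Ck.
  - exact: Ck.
  - exact: Cx.
move=> zT za zb zx; rewrite T1E; case: (m == a); first by apply: commrM.
by case: (m == b); [apply: commrD; apply: commrM|exact: zT].
Qed.

Let qdet_T1 : qdet q T1 = seqlift (qdet q T).
Proof.
have ne := adjacent_neq adj.
rewrite (qdet_morph q (@seqlift R V)); apply: (qdet_elementary adj _ _ _ kab kba kax).
- by move=> i j; exact: seqlift_dilateC.
- by move=> i j; exact: seqlift_dilateC.
- by move=> i j; exact: seqlift_shiftC.
- by move=> r; rewrite T1E eqxx.
- by move=> r; rewrite T1E eq_sym (negbTE ne) eqxx.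
- by move=> r c ca cb; rewrite T1E (negbTE ca) (negbTE cb).
Qed.

(** On [l]-th powers the elementary factor acts as a classical column operation, with [ka] and [kb]
    replaced by 1 and [x] by [x ^+ l]; hence [qdet_elementary] applies with [q = 1]. *)
Let qdet_T1X : qdet 1 (fun i j => T1 i j ^+ l) = qdet q T1 ^+ l.
Proof.
rewrite [RHS](_ : _ = seqlift (qdet 1 (fun i j => T i j ^+ l))); last first.
  by rewrite qdet_T1 (model_qdetX TS) rmorphXn.
rewrite (qdet_morph 1 (@seqlift R V)).
have ne := adjacent_neq adj.
apply: (qdet_elementary adj (ka := 1) (kb := 1) (x := x ^+ l)).
- by move=> i j; exact: commr1.
- by move=> i j; exact: commr1.
- by move=> i j; apply: commrX; exact: seqlift_shiftC.
- by rewrite mulr1.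
- by rewrite mulr1.
- by case: ifP => _; rewrite mulr1 mul1r scale1r.
- by move=> r; rewrite T1X (negbTE ne) mulr1 -rmorphXn.
- by move=> r; rewrite T1X eqxx mulr1 -!rmorphXn.
- by move=> r c ca cb; rewrite T1X (negbTE cb) -rmorphXn.
Qed.

(** As [T r0 b = 0], the letter [(r0, b)] acts in [T1] as [T r0 a] times the new variable. *)
Let relabel (p : 'I_n * 'I_n) := if p == (r0, b) then (r0, a) else p.

Let S1 : pred ('I_n * 'I_n) := fun p => S p || (p == (r0, b)).

Let T1v r c (f : nat -> V) k : T1 r c f k =
  if c == a then T r a (kappa ^+ k *: f k)
  else if c == b then
    T r b (kappa^-1 ^+ k *: f k) + T r a (if k is k'.+1 then f k' else 0)
  else T r c (f k).
Proof. by rewrite T1E; case: (c == a) => //; case: (c == b). Qed.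

(* The lowest-order term in the new variable of a word in [T1] is, up to a unit,
   the relabelled word in [T]. *)
Let word_lowest (w : seq ('I_n * 'I_n)) : all S1 w ->
  exists2 u : R, u \is a GRing.unit & forall v,
  let f := word T1 w ((fun k => if k == 0%N then v else 0) : nat -> V) : nat -> V in
  (forall k, (k < count_mem (r0, b) w)%N -> f k = 0)
  /\ f (count_mem (r0, b) w) = u *: word T (map relabel w) v.
Proof.
have ne := adjacent_neq adj.
elim: w => [_|p w IHw /= /andP[Sp /IHw[u u_unit Hu]]].
  by exists 1; [exact: unitr1|move=> v /=; rewrite /word !big_nil scale1r].
have [E|pn] := eqVneq p (r0, b).
  exists u => // v; have [low top] := Hu v.
  rewrite word_cons /relabel E eqxx add1n /= word_cons endo_mulE.
  have T1b f k : T1 r0 b f k = T r0 a (if k is k'.+1 then f k' else 0).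
    by rewrite T1v eq_sym (negbTE ne) eqxx (model_supp TS Sb) add0r.
  split=> [[|k]|].
  - by rewrite T1b endo0.
  - by rewrite ltnS T1b => /low ->; rewrite endo0.
  - by rewrite T1b top endoZ.
rewrite add0n.
have [pa|pa] := eqVneq p.2 a.
  exists (kappa ^+ count_mem (r0, b) w * u) => [|v].
    by rewrite unitrM unitrX.
  have [low top] := Hu v.
  rewrite word_cons /relabel (negbTE pn) word_cons /=.
  split=> [k /low fk|]; rewrite T1v pa eqxx; first by rewrite fk scaler0 endo0.
  by rewrite top endoZ endoZ scalerA.
have [pb|pb] := eqVneq p.2 b.
  exists (kappa^-1 ^+ count_mem (r0, b) w * u) => [|v].
    by rewrite unitrM unitrX ?unitrV.
  have [low top] := Hu v.
  rewrite word_cons /relabel (negbTE pn) word_cons /=.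
  (* The second summand of column [b] uses the coefficient of index one less, which is still below
     the lowest order. *)
  have prev k : (k <= count_mem (r0, b) w)%N ->
      T p.1 a (if k is k'.+1 then
        word T1 w ((fun k => if k == 0%N then v else 0) : nat -> V) k' else 0) = 0.
    by case: k => [_|k /low ->]; rewrite endo0.
  split=> [k lk|]; rewrite T1v pb eq_sym (negbTE ne) eqxx prev ?addr0 // 1?ltnW //.
    by rewrite low // scaler0 endo0.
  by rewrite top endoZ endoZ scalerA.
exists u => // v; have [low top] := Hu v.
rewrite word_cons /relabel (negbTE pn) word_cons /=.
split=> [k /low fk|]; rewrite T1v (negbTE pa) (negbTE pb).
  by rewrite fk endo0.
by rewrite top endoZ.
Qed.

Let count_relabel p w : count_mem p (map relabel w) =
  if p == (r0, b) then 0%N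
  else (count_mem p w + (p == (r0, a)) * count_mem (r0, b) w)%N.
Proof.
have ne := adjacent_neq adj.
elim: w => [|y w IHw] /=; first by rewrite muln0 if_same.
rewrite IHw /relabel; case: (eqVneq p (r0, b)) => [->|pn].
  case: (eqVneq y (r0, b)) => [_|/negbTE -> //].
  by rewrite xpair_eqE eqxx (negbTE ne).
case: (eqVneq y (r0, b)) => [->|yn]; last by rewrite addnA.
rewrite [(r0, b) == p]eq_sym (negbTE pn) [(r0, a) == p]eq_sym.
by rewrite add0n mulnDr muln1 addnCA.
Qed.

(** Induction on the number [m] of letters [(r0, b)]. Applied to constant series, words with more
    such letters do not reach degree [m], and those with fewer already have coefficient zero. For
    fixed [m] the relabelled words still have distinct contents, so independence for [T] applies. *)
Let indep_T1 : indep_words T1 S1.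
Proof.
move=> J P w c Pw Pinj sum0.
pose N j := count_mem (r0, b) (w j).
suff H m : forall j, P j -> N j = m -> c j = 0 by move=> j Pj; exact: (H (N j)).
elim/ltn_ind: m => m IHm.
have /choice[u Hu] j : exists u : R, P j -> u \is a GRing.unit /\ forall v,
    let f := word T1 (w j) ((fun k => if k == 0%N then v else 0) : nat -> V)
      : nat -> V in
    (forall k, (k < N j)%N -> f k = 0)
    /\ f (N j) = u *: word T (map relabel (w j)) v.
  case: (boolP (P j)) => [Pj|_]; last by exists 0.
  by have [u u_unit Hu] := word_lowest (Pw j Pj); exists u.
have cu0 : forall j, P j && (N j == m) -> c j * u j = 0.
  apply: (model_indep TS (w := fun j => map relabel (w j))).
  - move=> j /andP[/Pw/allP Sw _]; apply/allP => _ /mapP[p /Sw Sp ->].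
    by rewrite /relabel; case: eqP Sp => [_ _|pn /orP[|/eqP]].
  - move=> j j' /andP[Pj /eqP Nj] /andP[Pj' /eqP Nj'] /seq.permP ww'.
    apply: Pinj => //; apply: perm_eq_count_mem => p.
    have := ww' (pred1 p); rewrite !count_relabel.
    case: eqP => [-> _|_]; first by rewrite -/(N j) -/(N j') Nj.
    by rewrite -/(N j) -/(N j') Nj Nj' => /addIn.
  - apply: endo_eq => v; rewrite endo_sumE.
    have := congr1 (fun g : endo (seqmod V) =>
      (g ((fun k => if k == 0%N then v else 0) : nat -> V) : nat -> V) m) sum0.
    rewrite /= endo_sumE fct_sumE => E.
    apply: etrans E; rewrite [RHS](bigID (fun j => N j == m)) /=.
    rewrite [X in _ = _ + X]big1 ?addr0 => [|j /andP[Pj Nj]].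
      apply: eq_bigr => j /andP[Pj /eqP Nj]; rewrite -scalerA.
      by have [_ /(_ v)[_ <-]] := Hu j Pj; rewrite Nj.
    have [_ /(_ v)[low _]] := Hu j Pj; case: (ltngtP (N j) m) Nj => // ltN _.
      by rewrite (IHm _ ltN) // scale0r.
    by apply: etrans (congr1 ( *:%R (c j)) (low m ltN)) _; exact: scaler0.
move=> j Pj Nj; have [u_unit _] := Hu j Pj.
by apply: (mulIr u_unit); rewrite mul0r cu0 // Pj Nj /=.
Qed.

Lemma model_step : is_model T1 S1.
Proof.
have ne := adjacent_neq adj.
split=> //.
- move=> i j; rewrite /S1 negb_or => /andP[nS nrb]; rewrite T1E.
  have T00 c : ~~ S (i, c) -> T0 i c = 0.
    by move=> /(model_supp TS) E; rewrite /T0 E raddf0.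
  case: (eqVneq j a) => [ja|_]; first by rewrite T00 ?mul0r // -ja.
  case: (eqVneq j b) => [jb|_]; last exact: T00.
  rewrite T00 -?jb // mul0r add0r T00 ?mul0r //.
  apply/negP => /Sab[ir|Sib]; first by rewrite ir jb eqxx in nrb.
  by rewrite jb Sib in nS.
- move=> i j; rewrite qdet_T1.
  have DT r c : GRing.comm (seqlift (qdet q T)) (T0 r c).
    by rewrite /GRing.comm -!rmorphM (model_qdetC TS).
  rewrite T1E; case: (j == a); first by apply: commrM => //; exact: seqlift_dilateC.
  case: (j == b) => //; apply: commrD; apply: commrM => //; first exact: seqlift_dilateC.
  exact: seqlift_shiftC.
- by rewrite qdet_T1; apply: invertible_rmorph; exact: model_qdetU TS.
Qed.
End Step.
End Models.

(** * The diagonal model *)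

Lemma qdet_diag (R : comUnitRingType) (q : R) (n : nat) (A : algType R)
    (t : 'I_n -> 'I_n -> A) : (forall i j, i != j -> t i j = 0) ->
  qdet q t = \prod_(i < n) t i i.
Proof.
move=> t0; rewrite /qdet (bigD1 1%g) //= [X in _ + X]big1 ?addr0.
  rewrite /perm_length (_ : [set _ | _] = set0) ?cards0 ?expr0 ?scale1r.
    by apply: eq_bigr => i _; rewrite perm1.
  apply/setP => p; rewrite !inE !perm1; lia.
move=> s s1; have [i si] : exists i, s i != i.
  apply/existsP; apply: contraNT s1; rewrite negb_exists => /forallP si.
  by apply/eqP/permP => i; rewrite perm1; apply/eqP; rewrite -[_ == _]negbK.
pose F i := t i (s i); have Fi0 : F i = 0 by rewrite /F t0 // eq_sym.
(* With a zero factor, [F i = F i + F i], so the product equals its own double and is zero. *)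
have := @prod_update A _ (index_enum 'I_n) i F F F (index_enum_uniq _)
  (mem_index_enum _).
rewrite Fi0 addr0 => /(_ erefl (fun _ _ => erefl) (fun _ _ => erefl)) /eqP.
by rewrite -subr_eq0 opprD addNKr oppr_eq0 => /eqP ->; rewrite scaler0.
Qed.

Section DiagonalModel.
Variables (R : comUnitRingType) (q : R) (l n : nat).
Hypothesis q_unit : q \is a GRing.unit.
Hypothesis l_gt0 : (0 < l)%N.

Fact torus_pt_neq0 : ((fun=> 1) : {ffun 'I_n -> int} -> R^o) != 0.
Proof. by apply/eqP => /(congr1 (@^~ 0)) /eqP; rewrite oner_eq0. Qed.

Definition torus_mod : pmod R :=
  @PMod R ({ffun 'I_n -> int} -> R^o) (fun=> 1) torus_pt_neq0.

Definition translate (e : {ffun 'I_n -> int}) : endo torus_mod.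
Proof. by exists (fun f v => f (v + e)) => a f g. Defined.

Lemma translate0 : translate 0 = 1.
Proof. by apply: endo_eq => f; apply/funext => v /=; rewrite addr0. Qed.

Lemma translateD d e : translate d * translate e = translate (d + e).
Proof. by apply: endo_eq => f; apply/funext => v /=; rewrite addrA. Qed.

Lemma translateC d e : GRing.comm (translate d) (translate e).
Proof. by rewrite /GRing.comm !translateD addrC. Qed.

Lemma translate_sum (I : Type) (s : seq I) (e : I -> {ffun 'I_n -> int}) :
  \prod_(i <- s) translate (e i) = translate (\sum_(i <- s) e i).
Proof. by elim/big_rec2: _ => [|i d _ _ ->]; rewrite ?translate0 ?translateD. Qed.

Lemma translateX e m : translate e ^+ m = translate (e *+ m).
Proof.
elim: m => [|m IHm]; first by rewrite expr0 mulr0n translate0.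
by rewrite exprS IHm translateD mulrS.
Qed.

Let unit_vec (i : 'I_n) : {ffun 'I_n -> int} := [ffun k => (k == i)%:R].

Let T (i j : 'I_n) : endo torus_mod := if i == j then translate (unit_vec i) else 0.

Let TC i j z : (forall d, GRing.comm z (translate d)) -> GRing.comm z (T i j).
Proof. by move=> zC; rewrite /T; case: ifP => _ //; exact: commr0. Qed.

Let T_rtt : rtt q T.
Proof.
apply: qrel_rtt => //; split=> [i j k ljk|i h k lih|i j k m lij lkm|i j k m lij lkm].
- rewrite /T; case: (eqVneq i j) => [ij|_]; last by rewrite mul0r mulr0 scaler0.
  case: (eqVneq i k) => [ik|_]; last by rewrite mul0r mulr0 scaler0.
  by rewrite -ij -ik ltnn in ljk.
- rewrite /T; case: (eqVneq i k) => [ik|_]; last by rewrite mul0r mulr0 scaler0.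
  case: (eqVneq h k) => [hk|_]; last by rewrite mul0r mulr0 scaler0.
  by rewrite ik hk ltnn in lih.
- by rewrite /T; do 2![case: eqP => _]; rewrite ?mul0r ?mulr0 // translateC.
- have -> : T i m * T j k = 0.
    rewrite /T; case: (eqVneq i m) => [im|_]; last by rewrite mul0r.
    by case: (eqVneq j k) => [jk|_]; [move: lij lkm; rewrite im jk; lia|rewrite mulr0].
  rewrite scaler0 /T; do 2![case: eqP => _]; rewrite ?mul0r ?mulr0 ?subrr //.
  by rewrite translateC subrr.
Qed.

Let qdetT : qdet q T = translate (\sum_i unit_vec i).
Proof.
rewrite qdet_diag; last by move=> i j /negbTE ij; rewrite /T ij.
by rewrite -translate_sum; apply: eq_bigr => i _; rewrite /T eqxx.
Qed.

Let indepT : indep_words T (fun p => p.1 == p.2).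
Proof.
move=> J P w c Pw Pinj sum0 j0 Pj0.
pose e (v : seq ('I_n * 'I_n)) := \sum_(p <- v) unit_vec p.1.
have wordE (v : seq ('I_n * 'I_n)) : all (fun p => p.1 == p.2) v ->
    word T v = translate (e v).
  move=> /allP dv; rewrite /e -translate_sum; apply: eq_big_seq => p /dv.
  by rewrite /T => ->.
have e_inj v v' : all (fun p => p.1 == p.2) v -> all (fun p => p.1 == p.2) v' ->
    e v = e v' -> perm_eq v v'.
  have eE (u : seq ('I_n * 'I_n)) p : all (fun p => p.1 == p.2) u -> p.1 == p.2 ->
      e u p.1 = (count_mem p u)%:R.
    move=> + pp; elim: u => [_|y u IHu /= /andP[yy /IHu IH]].
      by rewrite /e big_nil ffunE.
    rewrite /e big_cons ffunE -/(e u) IH ffunE natrD; congr (_%:R + _).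
    case: y yy => y1 y2 /= /eqP ->; case: p pp {IH IHu} => p1 p2 /= /eqP ->.
    by rewrite xpair_eqE andbb eq_sym.
  move=> dv dv' E; apply: perm_eq_count_mem => p.
  have [pp|pp] := boolP (p.1 == p.2).
    have := congr1 (fun f : {ffun 'I_n -> int} => f p.1) E.
    by rewrite !eE // => /eqP; rewrite Num.Theory.eqr_nat => /eqP.
  rewrite !(count_memPn _) //.
    by apply: contraNN pp => /(allP dv').
  by apply: contraNN pp => /(allP dv).
(* A word translates by its content vector, so applying the relation to the indicator of [e (w j0)]
   and evaluating at 0 isolates the coefficient [c j0]. *)
have := congr1 (fun g : endo torus_mod =>
  (g (fun v => (v == e (w j0))%:R) : {ffun 'I_n -> int} -> R^o) 0) sum0.
rewrite /= endo_sumE fct_sumE (bigD1 j0) //= wordE ?Pw //= big1 => [|j /andP[Pj jj]].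
  by rewrite addr0 !fctE add0r eqxx /= => /eqP; rewrite [_ *: _]mulr1 => /eqP.
rewrite wordE ?Pw //= !fctE add0r; case: eqP => [E|_]; last exact: scaler0.
by rewrite (Pinj j j0) ?eqxx // in jj; apply: e_inj; rewrite ?Pw.
Qed.

Lemma diagonal_model : is_model q l T (fun p => p.1 == p.2).
Proof.
split=> //.
- by move=> i j /= /negbTE ij; rewrite /T ij.
- move=> i j k m; apply: TC => d; rewrite /T; case: ifP => _.
    by rewrite translateX; exact: translateC.
  by apply/commr_sym/commrX/commr0.
- by move=> i j; rewrite qdetT; apply: TC => d; exact: translateC.
- rewrite qdetT; exists (translate (- \sum_i unit_vec i)).
  by rewrite !translateD addrN addNr translate0.
- rewrite qdetT qdet_diag => [|i j /negbTE ij]; last first.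
    by rewrite /T ij expr0n gtn_eqF.
  rewrite translateX -sumrMnl -translate_sum; apply: eq_bigr => i _.
  by rewrite /T eqxx translateX.
Qed.

End DiagonalModel.

(** * Filling all matrix positions *)

Section FullModel.
Variables (R : comUnitRingType) (q : R) (l n : nat).
Hypothesis domR : forall x y : R, x * y = 0 -> x = 0 \/ y = 0.
Hypothesis q_unit : q \is a GRing.unit.
Hypothesis q_prim : l.-primitive_root q.
Hypothesis l_odd : odd l.

Definition has_model (S : pred ('I_n * 'I_n)) : Prop :=
  exists (V : pmod R) (T : 'I_n -> 'I_n -> endo V), is_model q l T S.

Let has_model_eq S S' : has_model S -> S =1 S' -> has_model S'.
Proof. by move=> m /funext <-. Qed.

Let step S (a b r0 : 'I_n) : has_model S -> (b == a.+1 :> nat) || (a == b.+1 :> nat) ->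
  ~~ S (r0, b) -> S (r0, a) -> (forall r, S (r, a) -> r = r0 \/ S (r, b)) ->
  has_model (fun p => S p || (p == (r0, b))).
Proof.
move=> [V [T TS]] adj Sb Sa Sab.
exists (seqmod V); eexists.
exact: (model_step domR q_unit q_prim l_odd TS adj Sb Sa Sab).
Qed.

(* The upper triangle is filled diagonal by diagonal, from right to left. *)
Let upper p c0 (x : 'I_n * 'I_n) := (x.1 <= x.2)%N && (x.2 - x.1 <= p + (c0 <= x.2))%N.

Let has_model_upper p : has_model (upper p n).
Proof.
elim: p => [|p IHp].
  exists (torus_mod R n); eexists.
  have := @diagonal_model R q l n q_unit (odd_gt0 l_odd).
  rewrite (_ : (fun x => _) = upper 0 n) => [m|]; first exact: m.
  apply/funext => -[[i lti] [j ltj]]; rewrite /upper -val_eqE /=; lia.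
(* In [upper p (n - j)] the last [j] columns already contain their entry on diagonal [p.+1]. *)
suff H j : (j <= n)%N -> has_model (upper p (n - j)).
  apply: (has_model_eq (H n (leqnn n))) => -[[i lti] [j ltj]].
  rewrite /upper /=; lia.
elim: j => [_|j IHj ltjn]; first by rewrite subn0.
have {IHj} := IHj (ltnW ltjn); set c := (n - j.+1)%N.
have -> : (n - j = c.+1)%N by rewrite /c; lia.
have ltc : (c < n)%N by rewrite /c; lia.
move: c ltc => c ltc m {j ltjn}.
(* For [c <= p], diagonal [p.+1] does not meet column [c]. *)
have [lepc|ltcp] := ltnP p c; last first.
  apply: (has_model_eq m) => -[[i lti] [j ltj]]; rewrite /upper /=; lia.
have lta : (c.-1 < n)%N by lia.
have ltr : (c - p.+1 < n)%N by lia.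
(* Column [c.-1] reaches up to row [c - p.+1], one row above column [c], so adding it to column [c]
   fills exactly this position. *)
apply: (has_model_eq (step (a := Ordinal lta) (b := Ordinal ltc)
  (r0 := Ordinal ltr) m _ _ _ _)).
- by rewrite /=; lia.
- by rewrite /upper /=; lia.
- by rewrite /upper /=; lia.
- move=> [r lr]; rewrite /upper /= => H.
  have [E|nE] := eqVneq r (c - p.+1)%N; [left|right].
    by apply: val_inj.
  by move: nE H; lia.
- move=> -[[i lti] [j ltj]]; rewrite /upper /= xpair_eqE -!val_eqE /=; lia.
Qed.

(* The lower triangle is filled diagonal by diagonal, from left to right. *)
Let lower p c0 (x : 'I_n * 'I_n) := (x.1 <= x.2 + p + (x.2 < c0))%N.

Let has_model_lower p : has_model (lower p 0).
Proof.
elim: p => [|p IHp].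
  apply: (has_model_eq (has_model_upper n)) => -[[i lti] [j ltj]].
  rewrite /upper /lower /=; lia.
suff H c : (c <= n)%N -> has_model (lower p c).
  apply: (has_model_eq (H n (leqnn n))) => -[[i lti] [j ltj]].
  rewrite /lower /=; lia.
elim: c => [_|c IHc ltc]; first exact: IHp.
have {IHc} m := IHc (ltnW ltc).
have [ltr|lecp] := ltnP (c + p.+1) n; last first.
  apply: (has_model_eq m) => -[[i lti] [j ltj]]; rewrite /lower /=; lia.
have lta : (c.+1 < n)%N by lia.
(* Here the source is column [c.+1], which reaches down to row [c + p.+1], one row below column
   [c]. *)
apply: (has_model_eq (step (a := Ordinal lta) (b := Ordinal ltc)
  (r0 := Ordinal ltr) m _ _ _ _)).
- by rewrite /=; lia.
- by rewrite /lower /=; lia.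
- by rewrite /lower /=; lia.
- move=> [r lr]; rewrite /lower /= => H.
  have [E|nE] := eqVneq r (c + p.+1)%N; [left|right].
    by apply: val_inj.
  by move: nE H; lia.
- move=> -[[i lti] [j ltj]]; rewrite /lower /= xpair_eqE -!val_eqE /=; lia.
Qed.

Lemma full_model : has_model (fun=> true).
Proof.
apply: (has_model_eq (has_model_lower n)) => -[[i lti] [j ltj]].
rewrite /lower /=; lia.
Qed.
End FullModel.

(** * The ring of cyclotomic integers *)

Section CyclotomicIntegers.
Variables (l : nat) (R : comUnitRingType) (eps : R).
Hypothesis l_gt0 : (0 < l)%N.
Hypothesis Zeps : is_Zeps l eps.

Let zevE p : zev eps p = (map_poly (intmul 1) p).[eps]. Proof. by []. Qed.

Let zevM p p' : zev eps (p * p') = zev eps p * zev eps p'.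
Proof. by rewrite !zevE rmorphM hornerM. Qed.

(** Transfers relations between [eps] and a complex root of unity. The remainder of [p] modulo the
    monic ['Phi_l] stays integral; if it vanishes at [zeta], it is divisible by the minimal
    polynomial of [zeta], which has the degree of ['Phi_l], so it is zero. *)
Let zev_eq0 (zeta : algC) p : l.-primitive_root zeta ->
  (zev eps p == 0) = ((map_poly intr p).[zeta] == 0).
Proof.
move=> zeta_prim; have [_ _ ker] := Zeps.
have Phi0 : (map_poly (intmul 1) 'Phi_l).[zeta] = 0 :> algC.
  apply/eqP; rewrite -/(root _ _) (Cintr_Cyclotomic zeta_prim).
  by rewrite root_cyclotomic.
apply/eqP/eqP => [p0|p0].
  have [r [k E]] : exists r k', p * 'X^k' = r * 'Phi_l * 'X^0.
    by apply/ker; rewrite p0 mul0r.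
  have := congr1 (fun p : {poly int} => (map_poly (intmul 1) p).[zeta] : algC) E.
  rewrite !rmorphM /= !hornerM Phi0 mulr0 mul0r map_polyXn hornerXn => /eqP.
  by rewrite mulf_eq0 expf_eq0 (prim_root_eq0 zeta_prim) (gtn_eqF l_gt0) andbF orbF => /eqP.
suff [r E] : exists r, p = r * 'Phi_l.
  have [_] := ker p 0%N; rewrite expr0 invr1 mulr1; apply.
  by exists r, 0%N; rewrite expr0 !mulr1.
have Phi_monic := Cyclotomic_monic l.
pose r := Pdiv.Ring.rmodp p 'Phi_l.
have E := Pdiv.RingMonic.rdivp_eq Phi_monic p.
exists (Pdiv.Ring.rdivp p 'Phi_l); rewrite {1}E.
rewrite -/r; suff -> : r = 0 by rewrite addr0.
have r0 : (map_poly intr r).[zeta] = 0.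
  move: p0; rewrite {1}E rmorphD rmorphM /= hornerD hornerM.
  by rewrite [X in _ * X]Phi0 mulr0 add0r.
have [m [minE _] rootE] := minCpolyP zeta.
have size_m : size m = size 'Phi_l.
  have := congr1 (fun p : {poly algC} => size p) minE.
  rewrite (minCpoly_cyclotomic zeta_prim) -(Cintr_Cyclotomic zeta_prim).
  by rewrite size_map_poly size_map_inj_poly //; exact: intr_inj.
have : m %| map_poly intr r.
  rewrite -rootE /root -map_poly_comp.
  rewrite (eq_map_poly (g := intr)) ?r0 // => z /=; exact: rmorph_int.
have size_r : size (map_poly intr r : {poly rat}) = size r.
  by rewrite size_map_inj_poly //; exact: intr_inj.
have [->//|rn0 /dvdp_leq] := eqVneq r 0.
rewrite -size_poly_eq0 size_r size_poly_eq0 => /(_ rn0).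
by rewrite size_m leqNgt /r Pdiv.Ring.ltn_rmodpN0 // monic_neq0.
Qed.

Lemma Zeps_domain (x y : R) : x * y = 0 -> x = 0 \/ y = 0.
Proof.
have [zeta zeta_prim] := C_prim_root_exists l_gt0.
have [eps_unit gen _] := Zeps.
have [p [k ->]] := gen x; have [p' [k' ->]] := gen y.
have u : eps ^- k * eps ^- k' \is a GRing.unit by rewrite unitrM !unitrV !unitrX.
move=> xy0; have : zev eps p * zev eps p' = 0.
  by apply: (mulIr u); rewrite mul0r -mulrACA.
rewrite -zevM => /eqP.
rewrite (zev_eq0 _ zeta_prim) rmorphM hornerM mulf_eq0.
by rewrite -!(zev_eq0 _ zeta_prim) => /orP[]/eqP->; rewrite mul0r; [left|right].
Qed.

Lemma Zeps_prim : l.-primitive_root eps.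
Proof.
have [zeta zeta_prim] := C_prim_root_exists l_gt0.
have epsX m : (eps ^+ m == 1) = (zeta ^+ m == 1).
  have := zev_eq0 ('X^m - 1) zeta_prim; rewrite zevE !rmorphB !rmorph1 /=.
  by rewrite !map_polyXn !hornerE !subr_eq0.
apply/andP; split=> //; apply/forallP => i.
rewrite unity_rootE epsX -(prim_order_dvd zeta_prim).
apply/eqP; apply/idP/eqP => [/dvdn_leq|->//]; have := ltn_ord i; lia.
Qed.
End CyclotomicIntegers.

(** * Induction principles from universal properties *)

Section Subalgebra.
Variables (R : comUnitRingType) (A : algType R) (P : A -> Prop).
Hypothesis P1 : P 1.
Hypothesis Plin : forall a u v, P u -> P v -> P (a *: u + v).
Hypothesis PM : forall u v, P u -> P v -> P (u * v).

Let subalg_pred : {pred A} := fun x => `[< P x >].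

Fact subalg_pred_closed : GRing.subalg_closed subalg_pred.
Proof.
split=> [|a u v /asboolP Pu /asboolP Pv|u v /asboolP Pu /asboolP Pv]; apply/asboolP.
- exact: P1.
- exact: Plin.
- exact: PM.
Qed.

HB.instance Definition _ := GRing.isSubalgClosed.Build R A subalg_pred subalg_pred_closed.

Record subalg := Subalg { subalg_val : A; _ : subalg_val \in subalg_pred }.

HB.instance Definition _ := [isSub for subalg_val].
HB.instance Definition _ := [Choice of subalg by <:].
HB.instance Definition _ := [SubChoice_isSubAlgebra of subalg by <:].

Let incl (x : subalg) : A := val x.

Fact incl_zmod_morphism : zmod_morphism incl. Proof. exact: raddfB. Qed.
Fact incl_monoid_morphism : monoid_morphism incl.
Proof. by split=> [|x y]; [exact: rmorph1|exact: rmorphM]. Qed.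
Fact incl_scalable : scalable incl. Proof. by move=> a x; exact: linearZ. Qed.

HB.instance Definition _ := GRing.isZmodMorphism.Build subalg A incl incl_zmod_morphism.
HB.instance Definition _ :=
  GRing.isMonoidMorphism.Build subalg A incl incl_monoid_morphism.
HB.instance Definition _ := GRing.isScalable.Build R subalg A *:%R incl incl_scalable.

(** Realizes a propositional predicate as an algebra in its own right, so that it can be a target of
    the universal properties. *)
Lemma subalgebra_embedding : exists (B : algType R) (incl : {lrmorphism B -> A}),
  [/\ injective incl, forall b, P (incl b) & forall x, P x -> exists b, incl b = x].
Proof.
exists subalg, (incl : {lrmorphism subalg -> A}); split.
- exact: val_inj.
- by case=> x Px; exact/asboolP.
- move=> x Px; have xP : x \in subalg_pred by exact/asboolP.
  by exists (Subalg xP).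
Qed.
End Subalgebra.

Section LiftMorphism.
Variables (R : comUnitRingType) (A B C : algType R).
Variables (incl : {lrmorphism B -> C}) (f : {lrmorphism A -> C}) (g : A -> B).
Hypothesis incl_inj : injective incl.
Hypothesis gE : forall a, incl (g a) = f a.

Fact lift_zmod_morphism : zmod_morphism g.
Proof. by move=> x y; apply: incl_inj; rewrite rmorphB /= !gE rmorphB. Qed.
Fact lift_monoid_morphism : monoid_morphism g.
Proof.
split=> [|x y]; apply: incl_inj; first by rewrite gE !rmorph1.
by rewrite rmorphM /= !gE rmorphM.
Qed.
Fact lift_scalable : scalable g.
Proof. by move=> a x; apply: incl_inj; rewrite linearZ /= !gE linearZ. Qed.

HB.instance Definition _ := GRing.isZmodMorphism.Build A B g lift_zmod_morphism.
HB.instance Definition _ := GRing.isMonoidMorphism.Build A B g lift_monoid_morphism.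
HB.instance Definition _ := GRing.isScalable.Build R A B *:%R g lift_scalable.

Lemma lift_lrmorphism : exists g' : {lrmorphism A -> B}, g' =1 g.
Proof. by exists (g : {lrmorphism A -> B}). Qed.
End LiftMorphism.

Section Generation.
Variables (R : comUnitRingType) (A : algType R) (P : A -> Prop).
Hypothesis P1 : P 1.
Hypothesis Plin : forall a u v, P u -> P v -> P (a *: u + v).
Hypothesis PM : forall u v, P u -> P v -> P (u * v).

(** The universal map to the subalgebra of [P], followed by the inclusion, fixes the generators; by
    uniqueness it is the identity, so every element lies in [P]. *)
Lemma Oq_Mn_generated (q : R) (n : nat) (t : 'I_n -> 'I_n -> A) :
  is_Oq_Mn q t -> (forall i j, P (t i j)) -> forall x, P x.
Proof.
move=> [[row col anti cross] univ] Pt x.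
have [B [incl [incl_inj Pincl inclP]]] := subalgebra_embedding P1 Plin PM.
have /choice[u uE] (p : 'I_n * 'I_n) : exists b, incl b = t p.1 p.2 by exact: inclP.
have qu : qrel q (fun i j => u (i, j)).
  split=> [i j k ljk|i h k lih|i j k l lij lkl|i j k l lij lkl]; apply: incl_inj;
    rewrite ?rmorphB /= ?linearZ /= !rmorphM /= !uE /=.
  - exact: row.
  - exact: col.
  - exact: anti.
  - exact: cross.
have [f [fE _]] := univ _ _ qu.
have [h [_ hE]] := univ _ _ (And4 row col anti cross).
have E1 : incl \o f =1 h by apply: hE => i j; rewrite /= fE uE.
have E2 : idfun =1 h by apply: hE.
have -> : x = incl (f x) by rewrite -[LHS]/(idfun x) E2 -E1.
exact: Pincl.
Qed.
End Generation.

(** Same argument as for [Oq_Mn_generated]: the localization maps to the subalgebra because the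
    latter contains the inverse of [iota d]. *)
Lemma localization_generated (R : comUnitRingType) (A AL : algType R) (d : A)
    (iota : {lrmorphism A -> AL}) (P : AL -> Prop) :
  P 1 -> (forall a u v, P u -> P v -> P (a *: u + v)) ->
  (forall u v, P u -> P v -> P (u * v)) ->
  is_localization d iota -> (forall a, P (iota a)) ->
  (forall y, iota d * y = 1 -> y * iota d = 1 -> P y) -> forall x, P x.
Proof.
move=> P1 Plin PM [[y [dy yd]] univ] Piota Pinv x.
have [B [incl [incl_inj Pincl inclP]]] := subalgebra_embedding P1 Plin PM.
have /choice[g0 g0E] a : exists b, incl b = iota a by exact: inclP.
have [g gE] := lift_lrmorphism incl_inj g0E.
have gd : invertible (g d).
  have [z zE] := inclP _ (Pinv y dy yd).
  by exists z; split; apply: incl_inj; rewrite rmorphM rmorph1 /= gE g0E zE.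
have [f [fE _]] := univ _ _ gd.
have [h [_ hE]] := univ _ iota (ex_intro _ y (conj dy yd)).
have E1 : incl \o f =1 h by apply: hE => a; rewrite /= fE gE g0E.
have E2 : idfun =1 h by apply: hE.
have -> : x = incl (f x) by rewrite -[LHS]/(idfun x) E2 -E1.
exact: Pincl.
Qed.

(** * Spanning by ordered words *)

Section Spanning.
Variables (R : comUnitRingType) (q : R) (n : nat) (A : algType R).
Variable t : 'I_n -> 'I_n -> A.
Hypothesis q_unit : q \is a GRing.unit.
Hypothesis tq : qrel q t.

Local Notation letters := (seq ('I_n * 'I_n)).

(** Repeated words are allowed; [word_span_uniq] merges them when independence has to be applied. *)
Inductive word_span (Q : letters -> Prop) : A -> Prop :=
| WordSpan0 : word_span Q 0
| WordSpanD c w x : Q w -> word_span Q x -> word_span Q (c *: word t w + x).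

Lemma word_spanD Q x y : word_span Q x -> word_span Q y -> word_span Q (x + y).
Proof.
move=> + Qy; elim=> [|c w {}x Qw _ IH]; first by rewrite add0r.
by rewrite -addrA; constructor.
Qed.

Lemma word_spanZ Q c x : word_span Q x -> word_span Q (c *: x).
Proof.
elim=> [|d w {}x Qw _ IH]; first by rewrite scaler0; constructor.
by rewrite scalerDr scalerA; constructor.
Qed.

Lemma word_span_word (Q : letters -> Prop) w : Q w -> word_span Q (word t w).
Proof.
move=> Qw; rewrite -[word t w]scale1r -[_ *: _]addr0.
by apply: WordSpanD => //; exact: WordSpan0.
Qed.

Lemma word_span_bind (Q Q' : letters -> Prop) x :
  (forall w, Q w -> word_span Q' (word t w)) -> word_span Q x -> word_span Q' x.
Proof.
move=> QQ'; elim=> [|c w {}x Qw _ IH]; first by constructor.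
by apply: word_spanD => //; apply: word_spanZ; exact: QQ'.
Qed.

Lemma word_span_mul (Q Q' : letters -> Prop) u v x :
  (forall w, Q w -> Q' (u ++ w ++ v)) -> word_span Q x ->
  word_span Q' (word t u * x * word t v).
Proof.
move=> QQ'; elim=> [|c w {}x Qw _ IH].
  by rewrite mulr0 mul0r; constructor.
rewrite mulrDr mulrDl; apply: word_spanD => //.
rewrite -scalerAr -scalerAl -!word_cat -catA.
by apply: word_spanZ; apply: word_span_word; exact: QQ'.
Qed.

(* Reordering two letters only adds a word of smaller weight, since
   [i * l + j * k < i * k + j * l] for [i < j] and [k < l]. *)
Let wt (w : letters) : nat := \sum_(p <- w) (p.1 * p.2)%N.

Let wt_cat u v : wt (u ++ v) = (wt u + wt v)%N.
Proof. exact: big_cat. Qed.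

Let wt_perm u v : perm_eq u v -> wt u = wt v.
Proof. exact: perm_big. Qed.

Definition lower_words w := word_span (fun v => (wt v < wt w)%N).

Let lowerD w x y : lower_words w x -> lower_words w y -> lower_words w (x + y).
Proof. exact: word_spanD. Qed.

Let swap p r : exists c, lower_words [:: p; r] (word t [:: p; r] - c *: word t [:: r; p]).
Proof.
have [row col anti cross] := tq.
have lower0 w x y : x = y -> lower_words w (x - y).
  by move=> ->; rewrite subrr; constructor.
have qVK x y : x = q *: y -> y = q^-1 *: x :> A.
  by move=> ->; rewrite scalerA mulVr // scale1r.
case: p r => [i k] [j m]; rewrite /word !big_cons !big_nil /= !mulr1.
have [lij|lji|/val_inj eij] := ltngtP i j; have [lkm|lmk|/val_inj ekm] := ltngtP k m.
- exists 1; rewrite scale1r cross //.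
  rewrite -[X in lower_words _ X]addr0; rewrite (_ : t i m * t j k = word t [:: (i, m); (j, k)]).
    constructor; last by constructor.
    by rewrite /wt !big_cons !big_nil /=; nia.
  by rewrite /word !big_cons big_nil mulr1.
- exists 1; apply: lower0; rewrite scale1r; exact: (anti _ _ _ _ lij lmk).
- by exists q; apply: lower0; rewrite ekm; exact: col.
- by exists 1; apply: lower0; rewrite scale1r (anti _ _ _ _ lji lkm).
- exists 1; rewrite scale1r -opprB cross // -scaleNr.
  rewrite -[X in lower_words _ X]addr0; rewrite (_ : t j k * t i m = word t [:: (j, k); (i, m)]).
    constructor; last by constructor.
    by rewrite /wt !big_cons !big_nil /=; nia.
  by rewrite /word !big_cons big_nil mulr1.
- by exists q^-1; apply: lower0; rewrite ekm; apply: qVK; exact: col.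
- by exists q; apply: lower0; rewrite eij; exact: row.
- by exists q^-1; apply: lower0; rewrite eij; apply: qVK; exact: row.
- by exists 1; apply: lower0; rewrite eij ekm scale1r.
Qed.

Let lower_mul u v w x : lower_words w x ->
  lower_words (u ++ w ++ v) (word t u * x * word t v).
Proof. by apply: word_span_mul => y; rewrite !wt_cat; lia. Qed.

Let lower_trans w w' x : wt w = wt w' -> lower_words w x -> lower_words w' x.
Proof. by rewrite /lower_words => ->. Qed.

Let move_letter p u v : exists c,
  lower_words (p :: u ++ v) (word t (p :: u ++ v) - c *: word t (u ++ p :: v)).
Proof.
elim: u => [|r u [c IH]]; first by exists 1; rewrite scale1r subrr; constructor.
have [d pr] := swap p r; exists (d * c).
have -> : word t (p :: (r :: u) ++ v) - (d * c) *: word t ((r :: u) ++ p :: v) =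
    word t [::] * (word t [:: p; r] - d *: word t [:: r; p]) * word t (u ++ v)
    + d *: (word t [:: r] * (word t (p :: u ++ v) - c *: word t (u ++ p :: v))
            * word t [::]).
  rewrite mulrBr !mulrBl mulrBr !mulrBl -!scalerAr -!scalerAl -!word_cat /= !cats0.
  by rewrite scalerBr scalerA addrA subrK.
apply: lowerD; first exact: (lower_mul [::] (u ++ v) pr).
apply: word_spanZ; apply: lower_trans (lower_mul [:: r] [::] IH).
by rewrite cats0; apply/wt_perm/permEl; exact: (perm_catCA [:: r] [:: p] (u ++ v)).
Qed.

(** The tail is brought into its final order by induction, then [move_letter] carries the first
    letter to its place; all errors are of smaller weight. *)
Let perm_word w w' : perm_eq w w' -> exists c,
  lower_words w (word t w - c *: word t w').
Proof.
elim: w w' => [|p w IHw] w' pw.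
  by move: pw; rewrite perm_sym => /perm_nilP ->; exists 1; rewrite scale1r subrr; constructor.
have pw' : p \in w' by rewrite -(perm_mem pw) mem_head.
case/splitPr: pw' pw => u v pw.
have {}pw : perm_eq w (u ++ v).
  by move: pw; rewrite perm_sym -cat1s perm_catCA perm_cons perm_sym.
have [c IH] := IHw _ pw; have [d mv] := move_letter p u v.
exists (c * d).
have -> : word t (p :: w) - (c * d) *: word t (u ++ p :: v) =
    word t [:: p] * (word t w - c *: word t (u ++ v)) * word t [::]
    + c *: (word t (p :: u ++ v) - d *: word t (u ++ p :: v)).
  rewrite mulrBr !mulrBl -!scalerAr -!scalerAl -!word_cat /= !cats0.
  by rewrite scalerBr scalerA addrA subrK.
apply: lowerD; first by have := lower_mul [:: p] [::] IH; rewrite cats0.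
apply: word_spanZ; apply: lower_trans mv.
by apply: wt_perm; rewrite perm_cons perm_sym.
Qed.

(** Strong induction on the weight: [perm_word] replaces [w] by a multiple of [g w] up to words of
    smaller weight. *)
Lemma word_span_reorder (g : letters -> letters) : (forall w, perm_eq w (g w)) ->
  forall w, word_span (fun v => exists u, v = g u) (word t w).
Proof.
move=> gP w; have [m] := ubnP (wt w); elim: m w => // m IHm w; rewrite ltnS => lewm.
have [c low] := perm_word (gP w).
rewrite -[word t w](subrK (c *: word t (g w))); apply: word_spanD.
  apply: word_span_bind low => v ltv; apply: IHm; exact: leq_trans lewm.
by apply: word_spanZ; apply: word_span_word; exists w.
Qed.

Lemma word_span_uniq Q x : word_span Q x -> exists (s : seq letters) (c : letters -> R),
  [/\ uniq s, forall w, w \in s -> Q w & x = \sum_(w <- s) c w *: word t w].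
Proof.
elim=> [|c w {}x Qw _ [s [d [us sQ ->]]]].
  by exists [::], (fun=> 0); rewrite big_nil.
have [ws|nws] := boolP (w \in s).
  exists s, (fun v => if v == w then c + d w else d v); split=> //.
  rewrite [X in _ + X](big_rem w ws) [RHS](big_rem w ws) /= eqxx scalerDl -addrA; congr (_ + (_ + _)).
  rewrite [LHS]big_seq [RHS]big_seq; apply: eq_bigr => v.
  by rewrite mem_rem_uniq // !inE => /andP[/negbTE ->].
exists (w :: s), (fun v => if v == w then c else d v); split.
- by rewrite /= nws.
- by move=> v; rewrite inE => /orP[/eqP ->|/sQ].
- rewrite big_cons eqxx; congr (_ + _).
  rewrite [LHS]big_seq [RHS]big_seq; apply: eq_bigr => v sv.
  by case: eqP => // vw; rewrite -vw sv in nws.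
Qed.

End Spanning.

Lemma Oq_Mn_word_span (R : comUnitRingType) (q : R) (n : nat) (A : algType R)
    (t : 'I_n -> 'I_n -> A) (g : seq ('I_n * 'I_n) -> seq ('I_n * 'I_n)) :
  q \is a GRing.unit -> is_Oq_Mn q t -> (forall w, perm_eq w (g w)) ->
  forall x, word_span t (fun v => exists u, v = g u) x.
Proof.
move=> q_unit Aq gP x.
have tq := proj1 Aq.
suff : word_span t (fun=> True) x.
  by apply: word_span_bind => w _; exact: word_span_reorder q_unit tq _ gP w.
move: x; apply: (@Oq_Mn_generated _ _ _ _ _ _ q n t Aq).
- by have := @word_span_word _ _ _ t (fun=> True) [::] I; rewrite /word big_nil.
- by move=> a u v su sv; apply: word_spanD => //; exact: word_spanZ.
- move=> u v + sv; elim=> [|c w {}u _ _ IH]; first by rewrite mul0r; constructor.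
  rewrite mulrDl; apply: word_spanD => //; rewrite -scalerAl; apply: word_spanZ.
  rewrite -[_ * v]mulr1 -[X in _ * X](_ : word t [::] = 1).
    by apply: word_span_mul sv.
  by rewrite /word big_nil.
- move=> i j; have := @word_span_word _ _ _ t (fun=> True) [:: (i, j)] I.
  by rewrite /word big_cons big_nil mulr1.
Qed.

(** * Ordered monomials and faithfulness of the model *)

Definition content_word (T : Type) (s : seq T) (e : T -> nat) : seq T :=
  flatten [seq nseq (e p) p | p <- s].

Lemma word_content_word (A : nzRingType) (n : nat) (t : 'I_n -> 'I_n -> A) s e :
  word t (content_word s e) = \prod_(p <- s) t p.1 p.2 ^+ e p.
Proof.
elim: s => [|p s IHs]; first by rewrite /content_word /word !big_nil.
rewrite big_cons -IHs [content_word _ _]/(_ ++ content_word s e) word_cat.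
by congr (_ * _); rewrite /word big_nseq iter_mulr_1.
Qed.

Lemma count_content_word (T : eqType) (s : seq T) e p :
  uniq s -> p \in s -> count_mem p (content_word s e) = e p.
Proof.
have cnt0 s' : p \notin s' -> count_mem p (content_word s' e) = 0%N.
  elim: s' => // r s' IH; rewrite inE negb_or => /andP[/negbTE pr ps].
  rewrite [content_word _ _]/(_ ++ content_word s' e) count_cat IH //.
  by rewrite count_nseq /= eq_sym pr.
elim: s => // r s IHs /= /andP[nrs us]; rewrite inE.
rewrite [content_word _ _]/(_ ++ content_word s e) count_cat count_nseq.
rewrite [pred1 _ _]/= [r == p]eq_sym.
have [E _|pr ps] := eqVneq p r.
  by rewrite mul1n cnt0 ?addn0 E.
by rewrite mul0n IHs.
Qed.

Section Faithful.
Variables (R : comUnitRingType) (q : R) (n : nat) (A B : algType R).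
Variables (t : 'I_n -> 'I_n -> A) (T : 'I_n -> 'I_n -> B) (f : {lrmorphism A -> B}).
Hypothesis q_unit : q \is a GRing.unit.
Hypothesis Aq : is_Oq_Mn q t.
Hypothesis ft : forall i j, f (t i j) = T i j.
Hypothesis indT : indep_words T (fun=> true).

Lemma indep_words_preim : indep_words t (fun=> true).
Proof.
move=> J P w c Pw Pinj sum0; apply: indT Pw Pinj _.
have := congr1 f sum0; rewrite raddf0 linear_sum /= => E; rewrite -[RHS]E.
apply: eq_bigr => j _; rewrite linearZ /=; congr (_ *: _).
rewrite /word rmorph_prod; apply: eq_bigr => p _; exact: esym (ft _ _).
Qed.

(** [g w] depends only on the content of [w], so different words in normal form have different
    contents, and their images are independent by [indT]. *)
Lemma model_faithful : injective f.
Proof.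
apply: raddf_inj => x fx0; have {}fx0 : f x = 0 := fx0.
pose g (w : seq ('I_n * 'I_n)) :=
  content_word (enum {: 'I_n * 'I_n}) (fun p => count_mem p w).
have gP w : perm_eq w (g w).
  apply: perm_eq_count_mem => p.
  by rewrite count_content_word ?enum_uniq // mem_enum.
have [s [c [us sg xE]]] := word_span_uniq (Oq_Mn_word_span q_unit Aq gP x).
rewrite xE big_tnth in fx0 *; apply: big1 => i _.
have -> : c (tnth (in_tuple s) i) = 0; last by rewrite scale0r.
apply: (indT (P := xpredT) (w := tnth (in_tuple s))
  (c := fun i => c (tnth (in_tuple s) i))) => //.
- by move=> j _; apply/allP.
- move=> j j' _ _ /seq.permP E; apply: (elimT (tuple_uniqP (in_tuple s)) us).
  have [u uE] := sg _ (mem_tnth j (in_tuple s)).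
  have [u' uE'] := sg _ (mem_tnth j' (in_tuple s)).
  rewrite uE uE'; rewrite /g /content_word; congr flatten; apply: eq_map => p.
  congr nseq; have := E (pred1 p).
  by rewrite uE uE' !count_content_word ?enum_uniq ?mem_enum.
- rewrite -[RHS]fx0 linear_sum; apply: eq_bigr => j _; rewrite linearZ /=.
  congr (_ *: _); rewrite /word rmorph_prod; apply: eq_bigr => p _; exact: esym (ft _ _).
Qed.
End Faithful.

Lemma Oq_Mn_comm (R : comUnitRingType) (q : R) (n : nat) (A : algType R)
    (t : 'I_n -> 'I_n -> A) (z : A) : is_Oq_Mn q t ->
  (forall i j, GRing.comm z (t i j)) -> forall x, GRing.comm z x.
Proof.
move=> Aq zt; apply: (Oq_Mn_generated _ _ _ Aq zt) => [|a u v zu zv|u v zu zv].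
- exact: commr1.
- by apply: commrD => //; rewrite /GRing.comm -scalerAr -scalerAl zu.
- exact: commrM.
Qed.

(** * The quantum Frobenius morphism *)

Section QuantumFrobenius.
Variables (R : comUnitRingType) (n l : nat) (A : algType R) (t : 'I_n -> 'I_n -> A).
Hypothesis tl_central : forall i j x, GRing.comm (t i j ^+ l) x.

Let qFrobE p : qFrob t l p =
  mmap (GRing.in_alg A) (fun k => t (enum_val k).1 (enum_val k).2 ^+ l) p.
Proof. by []. Qed.

Lemma qFrobD p p' : qFrob t l (p + p') = qFrob t l p + qFrob t l p'.
Proof. by rewrite !qFrobE mmapD. Qed.

Lemma qFrob0 : qFrob t l 0 = 0.
Proof. by rewrite qFrobE mmap0. Qed.

Lemma qFrobZ a p : qFrob t l (a *: p) = a *: qFrob t l p.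
Proof. by rewrite !qFrobE mmapZ mulr_algl. Qed.

Lemma qFrob_monoid_morphism : monoid_morphism (qFrob (n := n) t l).
Proof.
pose h (k : 'I_#|{: 'I_n * 'I_n}|) : A := t (enum_val k).1 (enum_val k).2 ^+ l.
have hC k x : GRing.comm x (h k) by apply: commr_sym; exact: tl_central.
have aC (p : Pol R n) m m' : GRing.comm (GRing.in_alg A (p@_m)) (mmap1 h m').
  by rewrite /GRing.comm mulr_algl mulr_algr.
by have [FM F1] := (@commr_mmap_is_multiplicative _ R A h (GRing.in_alg A) hC aC); split.
Qed.

Lemma qFrobX i j : qFrob t l (tbar R i j) = t i j ^+ l.
Proof. by rewrite qFrobE /tbar mmapX mmap1U enum_rankK. Qed.
End QuantumFrobenius.

(** * The basis for quantum matrices *)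

Section MnBasis.
Variables (R : comUnitRingType) (q : R) (n l : nat) (A : algType R).
Variables (t : 'I_n -> 'I_n -> A) (ord : rel ('I_n * 'I_n)).
Hypothesis q_unit : q \is a GRing.unit.
Hypothesis Aq : is_Oq_Mn q t.
Hypothesis l_gt0 : (0 < l)%N.
Hypothesis tl_central : forall i j x, GRing.comm (t i j ^+ l) x.

Local Notation positions := (sort ord (enum {: 'I_n * 'I_n})).

Let uniq_pos : uniq positions. Proof. by rewrite sort_uniq enum_uniq. Qed.
Let mem_pos p : p \in positions. Proof. by rewrite mem_sort mem_enum. Qed.

(** Each exponent is divided by [l]: the quotients form a Frobenius image, which is central and can
    be pulled to the front, and the remainders form [omono]. *)
Lemma Mn_span (a : A) : exists c : {ffun 'I_n * 'I_n -> 'I_l} -> Pol R n,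
  a = \sum_N qFrob t l (c N) * omono t ord N.
Proof.
pose g (w : seq ('I_n * 'I_n)) := content_word positions (fun p => count_mem p w).
have gP w : perm_eq w (g w).
  by apply: perm_eq_count_mem => p; rewrite count_content_word.
elim: (Oq_Mn_word_span q_unit Aq gP a) => [|c0 _ {}a [w ->] _ [c ->]].
  by exists (fun=> 0); rewrite big1 // => N _; rewrite qFrob0 mul0r.
pose N0 : {ffun 'I_n * 'I_n -> 'I_l} :=
  [ffun p => Ordinal (ltn_pmod (count_mem p w) l_gt0)].
pose m : Pol R n :=
  \prod_(p <- positions) tbar R p.1 p.2 ^+ (count_mem p w %/ l).
have [F1 FM] := qFrob_monoid_morphism tl_central.
have FX p k : qFrob t l (tbar R p.1 p.2 ^+ k) = (t p.1 p.2 ^+ l) ^+ k.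
  elim: k => [|k IHk]; first by rewrite !expr0 F1.
  by rewrite !exprS FM IHk qFrobX.
have wE : word t (g w) = qFrob t l m * omono t ord N0.
  rewrite word_content_word /omono (big_morph _ FM F1) -prod_commM.
    apply: eq_bigr => p _; rewrite FX ffunE /= -exprM mulnC -exprD.
    by rewrite -divn_eq.
  move=> p r; rewrite FX; apply: commr_sym; apply: commrX; apply: commr_sym.
  exact: tl_central.
exists (fun N => (if N == N0 then c0 *: m else 0) + c N).
under [RHS]eq_bigr => N _ do rewrite qFrobD mulrDl.
rewrite big_split /= [X in _ = X + _](bigD1 N0) //= eqxx [X in _ = _ + X + _]big1 ?addr0 => [|N /negbTE ->].
  by rewrite qFrobZ -scalerAl wE.
by rewrite qFrob0 mul0r.
Qed.

Hypothesis ind : indep_words t (fun=> true).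

(** A monomial in the [l]-th powers times an [omono] is a word with letter counts of the form
    [m * l + N]. Since [N < l], Euclidean division recovers both exponents from the content, so
    [ind] applies. *)
Lemma Mn_free (c : {ffun 'I_n * 'I_n -> 'I_l} -> Pol R n) :
  \sum_N qFrob t l (c N) * omono t ord N = 0 -> forall N, c N = 0.
Proof.
move=> sum0.
pose d := #|{: 'I_n * 'I_n}|.
(* A common size bound, so that all coefficients are indexed by one finite type [J]. *)
pose K := (\max_N msize (c N))%N.
have msK N : (msize (c N) <= K)%N by rewrite /K; exact: (leq_bigmax N).
(* The positions in the order of the polynomial variables, which may differ from the order given by
   [ord]. *)
pose s : seq ('I_n * 'I_n) := [seq enum_val k | k <- index_enum 'I_d].
have us : uniq s by rewrite map_inj_uniq ?index_enum_uniq //; exact: enum_val_inj.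
have sT p : p \in s by apply/mapP; exists (enum_rank p); rewrite ?mem_index_enum ?enum_rankK.
pose J : finType := ({ffun 'I_n * 'I_n -> 'I_l} * 'X_{1..d < K})%type.
pose w (x : J) :=
  content_word s (fun p => (l * x.2 (enum_rank p))%N)
    ++ content_word positions (fun p => nat_of_ord (x.1 p)).
have cw x p : count_mem p (w x) = (x.2 (enum_rank p) * l + x.1 p)%N.
  by rewrite /w count_cat !count_content_word // mulnC.
have c0 : forall x : J, xpredT x -> (c x.1)@_(x.2 : 'X_{1..d}) = 0.
  apply: (ind (P := xpredT) (w := w) (c := fun x : J => (c x.1)@_(x.2 : 'X_{1..d}))).
  - by move=> x _; apply/allP.
  - move=> [N m] [N' m'] _ _ /seq.permP E.
    have {}E p : (m (enum_rank p) * l + N p = m' (enum_rank p) * l + N' p)%N.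
      by have := E (pred1 p); rewrite !cw.
    congr (_, _).
      apply/ffunP => p; apply/val_inj => /=.
      by have := congr1 (modn^~ l) (E p); rewrite !modnMDl !modn_small.
    apply/val_inj/mnmP => k /=; rewrite -[k]enum_valK.
    have := congr1 (divn^~ l) (E (enum_val k)).
    by rewrite !divnMDl // !divn_small // !addn0.
  - rewrite -[RHS]sum0 -(pair_bigA _ (fun N (m : 'X_{1..d < K}) =>
      (c N)@_(m : 'X_{1..d}) *: word t (w (N, m)))) /=.
    apply: eq_bigr => N _.
    rewrite /qFrob -[fun c => c%:A]/(GRing.in_alg A) (mmapE K (msK N)) mulr_suml.
    apply: eq_bigr => m _; rewrite /= mulr_algl -scalerAl; congr (_ *: _).
    rewrite /w word_cat !word_content_word; congr (_ * _).
    rewrite /s big_map /mmap1 /=; apply: eq_bigr => k _.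
    by rewrite enum_valK exprM.
move=> N; apply/mpolyP => m; rewrite mcoeff0.
have [ltm|lem] := ltnP (mdeg m) K; first exact: (c0 (N, BMultinom ltm) isT).
apply: memN_msupp_eq0; apply: contraL lem => /msize_mdeg_lt ltm.
by rewrite -ltnNge; exact: leq_trans (msK N).
Qed.
End MnBasis.

(** * Localization and the basis for the quantum general linear group *)

Lemma localization_fraction (R : comUnitRingType) (A AL : algType R) (d : A)
    (iota : {lrmorphism A -> AL}) : is_localization d iota ->
  (forall a, GRing.comm d a) ->
  forall x, exists a k, x * iota d ^+ k = iota a.
Proof.
move=> loc dC.
have diC k a : GRing.comm (iota d ^+ k) (iota a).
  by apply/commr_sym/commrX; rewrite /GRing.comm -!rmorphM dC.
(* As [d] is central, fractions admit common denominators and form a subalgebra. *)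
apply: (localization_generated _ _ _ loc).
- by exists 1, 0%N; rewrite expr0 mulr1 rmorph1.
- move=> c u v [a [k ua]] [b [m vb]].
  exists (c *: a * d ^+ m + b * d ^+ k), (k + m)%N.
  rewrite rmorphD !rmorphM /= linearZ /= !rmorphXn /= -ua -vb.
  rewrite mulrDl -!scalerAl; congr (_ *: _ + _); first by rewrite exprD mulrA.
  by rewrite addnC exprD mulrA.
- move=> u v [a [k ua]] [b [m vb]]; exists (a * b), (m + k)%N.
  by rewrite rmorphM /= -ua exprD mulrA -(mulrA u) vb -!mulrA diC.
- by move=> a; exists a, 0%N; rewrite expr0 mulr1.
- by move=> y _ yd; exists 1, 1%N; rewrite expr1 yd rmorph1.
Qed.

Theorem theorem2p3 (l n : nat) (R : comUnitRingType) (eps : R)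
  (A : algType R) (t : 'I_n -> 'I_n -> A)
  (AGL : algType R) (iota : {lrmorphism A -> AGL})
  (C : comAlgType R) (j : {lrmorphism Pol R n -> C})
  (FrGL : {lrmorphism C -> AGL})
  (ord : rel ('I_n * 'I_n)) :
  odd l ->
  is_Zeps l eps ->
  is_Oq_Mn eps t ->
  is_localization (qdet eps t) iota ->
  is_localization (Dbar R n) j ->
  (forall p : Pol R n, FrGL (j p) = iota (qFrob t l p)) ->
  total ord -> transitive ord -> antisymmetric ord ->
  [/\ (* basis of O_eps(M_n) over O(M_n) *)
      (forall a : A, exists c : {ffun 'I_n * 'I_n -> 'I_l} -> Pol R n,
         a = \sum_N qFrob t l (c N) * omono t ord N),
      (forall c : {ffun 'I_n * 'I_n -> 'I_l} -> Pol R n,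
         \sum_N qFrob t l (c N) * omono t ord N = 0 -> forall N, c N = 0),
      (* basis of O_eps(GL_n) over O(GL_n) *)
      (forall a : AGL, exists c : {ffun 'I_n * 'I_n -> 'I_l} -> C,
         a = \sum_N FrGL (c N) * iota (omono t ord N)),
      (forall c : {ffun 'I_n * 'I_n -> 'I_l} -> C,
         \sum_N FrGL (c N) * iota (omono t ord N) = 0 -> forall N, c N = 0)
    & (* the rank *)
      #|{: {ffun 'I_n * 'I_n -> 'I_l}}| = (l ^ (n * n))%N].
Proof.
move=> l_odd Zeps Aq locA locC FrE _ _ _.
have l_gt0 := odd_gt0 l_odd.
have domR := Zeps_domain l_gt0 Zeps.
have q_prim := Zeps_prim l_gt0 Zeps.
have q_unit : eps \is a GRing.unit by case: Zeps.
have [V [T TM]] := full_model n domR q_unit q_prim l_odd.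
(* [f] is the representation of [A] on the full model; centrality and the determinant identities
   hold in the model and are pulled back along the injective [f]. *)
have [f [ft _]] := proj2 Aq _ _ (rtt_qrel q_unit (model_rtt TM)).
have ind := model_indep TM.
have f_inj := model_faithful q_unit Aq ft ind.
have {}ind := indep_words_preim ft ind.
have tl_central i k x : GRing.comm (t i k ^+ l) x.
  apply: (Oq_Mn_comm Aq) => i' k'; apply: f_inj.
  by rewrite !rmorphM !rmorphXn /= !ft; exact: model_central TM _ _ _ _.
set D := qdet eps t in locA.
have fD : f D = qdet eps T.
  by rewrite qdet_morph; congr qdet; apply/funext => i; apply/funext => k.
have DC x : GRing.comm D x.
  apply: (Oq_Mn_comm Aq) => i k; apply: f_inj.
  by rewrite !rmorphM /= fD ft; exact: model_qdetC TM _ _.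
have DX : qdet 1 (fun i k => t i k ^+ l) = D ^+ l.
  apply: f_inj; rewrite qdet_morph rmorphXn /= fD -(model_qdetX TM).
  congr qdet; apply/funext => i; apply/funext => k.
  by rewrite rmorphXn /= ft.
(* [f] makes the determinant invertible, so it factors through [iota]; injectivity of [f] passes to
   [iota]. *)
have iota_inj : injective iota.
  have fDU : invertible (f D) by rewrite fD; exact: model_qdetU TM.
  have [h [hE _]] := proj2 locA _ f fDU.
  by move=> x y E; apply: f_inj; rewrite -!hE E.
have FrD : FrGL (j (Dbar R n)) = iota D ^+ l.
  transitivity (iota (qdet 1 (fun i k => t i k ^+ l))); last by rewrite DX rmorphXn.
  rewrite /Dbar (qdet_morph 1 j) (qdet_morph 1 FrGL) (qdet_morph 1 iota).
  congr qdet; apply/funext => i; apply/funext => k.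
  by rewrite [LHS]FrE qFrobX.
have span := Mn_span ord q_unit Aq l_gt0 tl_central.
have free := Mn_free (ord := ord) l_gt0 ind.
have DiC k x : GRing.comm (iota D ^+ k) (iota x).
  by apply/commr_sym/commrX; rewrite /GRing.comm -!rmorphM DC.
split=> //.
- move=> x; have [a [k xa]] := localization_fraction locA DC x.
  have [[y [Dy yD]] _] := locC.
  (* If [x] is [a] over [D ^+ k], enlarging the fraction by [D ^+ (l.-1 * k)] gives the denominator
     [D ^+ (l * k)], whose inverse is the Frobenius image [FrGL y ^+ k]. *)
  have [c cE] := span (a * D ^+ (l.-1 * k)).
  have comm_Fy : GRing.comm (FrGL (j (Dbar R n))) (FrGL y).
    by rewrite /GRing.comm -!rmorphM mulrC.
  have yF : iota D ^+ (l * k) * FrGL y ^+ k = 1.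
    by rewrite exprM -FrD -exprMn_comm // -rmorphM Dy rmorph1 expr1n.
  have Fy : FrGL y ^+ k * iota D ^+ (l * k) = 1.
    rewrite exprM -FrD -exprMn_comm; last exact: commr_sym.
    by rewrite -rmorphM yD rmorph1 expr1n.
  have FyC z : GRing.comm (FrGL y ^+ k) (iota z).
    rewrite /GRing.comm -[LHS]mulr1 -yF -!mulrA.
    rewrite [iota z * (_ * _)]mulrA -DiC -mulrA.
    by rewrite (mulrA (FrGL y ^+ k) (iota D ^+ _)) Fy mul1r.
  exists (fun N => y ^+ k * j (c N)).
  have -> : x = FrGL y ^+ k * iota (a * D ^+ (l.-1 * k)).
    rewrite FyC rmorphM rmorphXn /= -xa -(mulrA x) -exprD -mulSn prednK //.
    by rewrite -mulrA yF mulr1.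
  rewrite cE linear_sum mulr_sumr; apply: eq_bigr => N _.
  by rewrite !rmorphM rmorphXn /= FrE mulrA.
- move=> c sum0.
  have Cfrac := localization_fraction locC (fun x => mulrC _ x).
  have /choice[p pE] N : exists pk, c N * j (Dbar R n) ^+ pk.2 = j pk.1.
    by have [a [k E]] := Cfrac (c N); exists (a, k).
  have [[y [Dy _]] _] := locC.
  (* A common denominator: multiplication by the [K]-th power of the determinant turns every [c N]
     into the image of a polynomial [p' N]. *)
  pose K := (\max_N (p N).2)%N.
  pose p' N := (p N).1 * Dbar R n ^+ (K - (p N).2).
  have p'E N : c N * j (Dbar R n) ^+ K = j (p' N).
    rewrite /p' rmorphM rmorphXn /= -pE -mulrA -exprD subnKC //.
    by rewrite /K; exact: (leq_bigmax N).
  have p'0 N : p' N = 0.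
    apply: free; apply: iota_inj; rewrite raddf0 linear_sum /=.
    (* The factor [iota D ^+ (l * K)] is the Frobenius image of [j (Dbar R n) ^+ K], so it clears
       all denominators of the relation at once. *)
    have := congr1 ( *%R (iota D ^+ (l * K))) sum0.
    rewrite mulr0 mulr_sumr; apply: etrans.
    apply: eq_bigr => M _; rewrite rmorphM /= -FrE -p'E rmorphM rmorphXn /= FrD -exprM.
    by rewrite mulrA; congr (_ * _); rewrite exprM -FrD -rmorphXn -!rmorphM mulrC.
  move=> N; have := p'E N; rewrite p'0 raddf0 => /(congr1 (fun z => z * y ^+ K)).
  by rewrite mul0r -mulrA -exprMn Dy expr1n mulr1.
- by rewrite card_ffun card_prod !card_ord.
Qed.
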